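(* Let $k\ge0$ and $n\ge k+2$ be integers, $\mathcal{Z}\in\mathrm{Mat}_{n,k+2}^{>0}$ and $Y\in\mathrm{Gr}_{k,k+2}^{\mathrm{wcb}}$. Then $Y\in\mathcal{A}_{n,k,2}$ if and only if $w_{n,k,2}(Y,\mathcal{Z})=\left\lfloor\frac{k+1}{2}\right\rfloor$ and $Y$ satisfies the coarse boundary conditions, i.e. $\langle Y,i,i+1\rangle\ge0$ for all $1\le i\le n-1$ and $(-1)^{k+1}\langle Y,n,1\rangle\ge0$.
   Context: $\mathrm{Gr}_{k,n}$ is the real Grassmannian of $k$-planes in $\mathbb{R}^n$, a point being represented by a $k\times n$ matrix whose rows span it; $\mathrm{Gr}_{k,n}^{\ge0}$ is the set of points having a representative all of whose maximal minors are $\ge0$. $\mathrm{Mat}_{n,k+2}^{>0}$ is the set of real $n\times(k+2)$ matrices all of whose maximal minors (rows in increasing order) are positive; the rows of $\mathcal{Z}$ are $\mathcal{Z}_1,\dots,\mathcal{Z}_n\in\mathbb{R}^{k+2}$. The amplituhedron $\mathcal{A}_{n,k,2}\subset\mathrm{Gr}_{k,k+2}$ is the image of $\mathrm{Gr}_{k,n}^{\ge0}$ under the map sending the point represented by $C$ to the point represented by $C\mathcal{Z}$. For $Y\in\mathrm{Gr}_{k,k+2}$ with a representative with rows $Y_1,\dots,Y_k$, the twistor coordinates are $\langle Y,i,j\rangle:=\det(Y_1,\dots,Y_k,\mathcal{Z}_i,\mathcal{Z}_j)$; they are defined up to a common nonzero factor. $\mathrm{Gr}_{k,k+2}^{\mathrm{wcb}}$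 is the set of $Y\in\mathrm{Gr}_{k,k+2}$ such that $\langle Y,i,i+1\rangle\ne0$ for $1\le i\le n-1$ and $\langle Y,n,1\rangle\neq0$. Winding number. Let $V_Y=\mathbb{R}^{k+2}/Y\simeq\mathbb{R}^2$, $\pi_Y$ the quotient map, $Z_i=\pi_Y(\mathcal{Z}_i)$. A representative of $Y$ orients $V_Y$: $(\pi_Y(f_1),\pi_Y(f_2))$ is positive iff $\det(Y_1,\dots,Y_k,f_1,f_2)>0$. For $Y\in\mathrm{Gr}_{k,k+2}^{\mathrm{wcb}}$ the closed polygon $P(Y,\mathcal{Z})$ formed by the oriented segments $[Z_1,Z_2],\dots,[Z_{n-1},Z_n],[Z_n,Z_1]$ avoids the origin, and $w_{n,k,2}(Y,\mathcal{Z})\in\mathbb{Z}$ is its winding number around the origin of $V_Y$ (the degree of $x\mapsto x/\|x\|$ from $P(Y,\mathcal{Z})$ to the unit circle), for the orientation of $V_Y$ given by the representative. The right-hand side of the equivalence is understood as: for some choice of representative of $Y$, both the coarse boundary inequalities and the winding number equality hold. *)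

(* Defs.v *)
From HB Require Import structures.
From mathcomp Require Export all_boot all_order all_algebra.
From mathcomp Require Export all_classical all_reals all_analysis.
Export Order.TTheory GRing.Theory Num.Theory.
Export numFieldNormedType.Exports.

Set Implicit Arguments.
Unset Strict Implicit.
Unset Printing Implicit Defensive.

Local Open Scope classical_set_scope.
Local Open Scope ring_scope.

Section Grassmannian.
Variable R : realType.

Definition Gr (k m : nat) : set {vspace 'rV[R]_m} := [set V | \dim V = k].

(* When [\dim V = k], the [k] spanning rows are automatically independent. *)
Definition represents (k m : nat) (C : 'M[R]_(k, m)) (V : {vspace 'rV[R]_m}) :=
  V = <<[seq row i C | i : 'I_k]>>%VS.

Definition increasing (p q : nat) (f : 'I_p -> 'I_q) :=
  {homo f : i j / (i < j)%N}.

Definition Gr_ge0 (k n : nat) : set {vspace 'rV[R]_n} :=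
  [set V | Gr k V /\ exists2 C : 'M[R]_(k, n), represents C V &
     forall f : 'I_k -> 'I_n, increasing f -> 0 <= \det (colsub f C)].

Definition Mat_gt0 (n m : nat) : set 'M[R]_(n, m) :=
  [set Z | forall f : 'I_m -> 'I_n, increasing f -> 0 < \det (rowsub f Z)].

Definition amplituhedron (n k : nat) (Z : 'M[R]_(n, k + 2)) :
    set {vspace 'rV[R]_(k + 2)} :=
  [set Y | Gr k Y /\ exists2 V, Gr_ge0 k V &
     exists2 C : 'M[R]_(k, n), represents C V & represents (C *m Z) Y].

Definition bracket (k : nat) (C : 'M[R]_(k, k + 2)) (u v : 'rV[R]_(k + 2)) : R :=
  \det (col_mx C (col_mx u v) : 'M[R]_(k + 2)).

(* Indices run over [0, ..., n - 1] instead of [1, ..., n]. *)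
Definition twistor (n k : nat) (Z : 'M[R]_(n, k + 2)) (C : 'M[R]_(k, k + 2))
  (i j : 'I_n) : R := bracket C (row i Z) (row j Z).

(* [ordS] is the cyclic successor, so [i = n - 1] gives the pair (n, 1). *)
Definition Gr_wcb (n k : nat) (Z : 'M[R]_(n, k + 2)) :
    set {vspace 'rV[R]_(k + 2)} :=
  [set Y | Gr k Y /\ exists2 C : 'M[R]_(k, k + 2), represents C Y &
     forall i : 'I_n, twistor Z C i (ordS i) != 0].

Definition coarse_boundary (n k : nat) (Z : 'M[R]_(n, k + 2))
    (C : 'M[R]_(k, k + 2)) :=
  (forall i j : 'I_n, j = i.+1 :> nat -> 0 <= twistor Z C i j) /\
  (forall i j : 'I_n, i.+1 = n -> j = 0%N :> nat ->
     0 <= (-1) ^+ (k + 1) * twistor Z C i j).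

End Grassmannian.

Section WindingNumber.
Variable R : realType.

(* The Euclidean normalization: the library norm on row vectors is the sup
   norm.  The value at the origin is [0], which is not on the unit circle. *)
Definition normalize (x : 'rV[R]_2) : 'rV[R]_2 :=
  (Num.sqrt (x 0 0 ^+ 2 + x 0 1 ^+ 2))^-1 *: x.

Definition unit_circle (t : R) : 'rV[R]_2 :=
  \row_(j < 2) (if j == 0 then cos t else sin t).

(* The degree of [normalize \o gamma], for a closed path [gamma] on [a, b],
   computed from a continuous lift to the universal cover of the circle.  The
   lift can only exist if [gamma] avoids the origin on [a, b]. *)
Definition has_winding_number (a b : R) (gamma : R -> 'rV[R]_2) (w : int) :=
  gamma a = gamma b /\
  exists theta : R -> R,
    [/\ {within `[a, b], continuous theta},
        forall t, t \in `[a, b] -> normalize (gamma t) = unit_circle (theta t)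
      & theta b - theta a = 2 * pi * w%:~R].

(* On [0, n], [gamma] runs through the segments [p_0, p_1], ...,
   [p_(n-1), p_0], each one in unit time. *)
Definition closed_polygon (n : nat) (p : 'I_n -> 'rV[R]_2)
    (gamma : R -> 'rV[R]_2) :=
  forall (i : 'I_n) (s : R), 0 <= s <= 1 ->
    gamma (i%:R + s) = (1 - s) *: p i + s *: p (ordS i).

(* [v |-> v *m P] induces an isomorphism from the quotient of R^(k+2) by the
   row space of [C] onto R^2; it carries the orientation of the quotient
   attached to the representative [C] to the standard one.  Two such [P] differ
   by an element of GL_2 of positive determinant. *)
Definition oriented_quotient (k : nat) (C : 'M[R]_(k, k + 2))
    (P : 'M[R]_(k + 2, 2)) :=
  [/\ row_full P,
      forall v : 'rV[R]_(k + 2), v *m P = 0 <-> (v <= C)%MS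
    & forall f1 f2 : 'rV[R]_(k + 2),
        0 < bracket C f1 f2 <-> 0 < \det (col_mx (f1 *m P) (f2 *m P) : 'M[R]_2)].

(* [w] is the winding number, around the origin of the quotient oriented by
   [C], of the closed polygon through the images of the rows of [Z].  It does
   not depend on the coordinates [P], GL_2^+(R) being connected. *)
Definition has_polygon_winding (n k : nat) (Z : 'M[R]_(n, k + 2))
    (C : 'M[R]_(k, k + 2)) (w : int) :=
  exists P gamma,
    [/\ oriented_quotient C P,
        closed_polygon (fun i : 'I_n => row i Z *m P) gamma
      & has_winding_number 0 n%:R gamma w].

End WindingNumber.

(* Main.v *)
(* Let z_i be the image of Z_i in the oriented plane R^(k+2)/Y.  The coarse
   boundary signs say that all segments but the last turn counterclockwise by
   an angle in (0, pi); let phi_i be the angle swept from z_1 to z_i.  The sign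
   of <Y,n,1> then makes w = floor((k+1)/2) equivalent to
   k pi < phi_n < (k+1) pi.

   If phi_n >= K pi, the linear relations between z_1, z_i, z_(i+1) at the K
   steps where phi crosses a multiple of pi are, with alternating signs, the rows
   of a matrix C with nonnegative minors such that C Z maps to 0 in the plane.
   For K = k this gives a preimage of Y; for K = k + 2 it contradicts
   det (C Z) > 0, which bounds phi_n from above.

   Conversely let Y come from a nonnegative C.  If phi_n < (k-1) pi, the
   vector w_i = det(z_1, z_i), killed by C, has the signs of a polynomial of degree
   k - 1 at the phi_i, so it is T s for a rescaled Vandermonde matrix T with
   positive minors; then det (C T) > 0 by Cauchy-Binet while C T s = 0.  The sign
   of <Y,n,1> excludes the remaining ranges by parity. *)

Require Import Defs.
From mathcomp Require Import fingroup perm.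
From mathcomp Require Import ring lra zify.

Set Implicit Arguments.
Unset Strict Implicit.
Unset Printing Implicit Defensive.

Local Open Scope ring_scope.

(** * Cauchy-Binet for alternating multilinear forms of the rows *)

Section RowForms.
Variables (R : comNzRingType) (p m : nat).

(** Multilinearity is encoded as the full expansion on a product, the form in which Cauchy-Binet
    uses it. The instances are the determinant and the bracket as a function of its first rows. *)
Definition row_multilinear (G : 'M[R]_(p, m) -> R) :=
  forall n (A : 'M[R]_(p, n)) (B : 'M[R]_(n, m)),
    G (A *m B) =
    \sum_(f : {ffun 'I_p -> 'I_n}) (\prod_i A i (f i)) * G (rowsub f B).

Definition row_alternating (G : 'M[R]_(p, m) -> R) :=
  forall (s : 'S_p) M, G (row_perm s M) = (-1) ^+ s * G M.

(* Summing the multilinear expansion over all precompositions of [f] with a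
   permutation gives Cauchy-Binet without having to sort the indices. *)
Lemma cauchy_binet_unordered (G : 'M[R]_(p, m) -> R) n
    (A : 'M[R]_(p, n)) (B : 'M[R]_(n, m)) :
  row_multilinear G -> row_alternating G ->
  (p`!)%:R * G (A *m B) =
  \sum_(f : {ffun 'I_p -> 'I_n}) \det (colsub f A) * G (rowsub f B).
Proof.
move=> Gml Galt.
have Gs (s : 'S_p) : G (A *m B) =
    \sum_(f : {ffun 'I_p -> 'I_n})
      ((-1) ^+ s * \prod_i A i (f (s i))) * G (rowsub f B).
  pose h (f : {ffun 'I_p -> 'I_n}) := [ffun i => f (s i)].
  pose h' (f : {ffun 'I_p -> 'I_n}) := [ffun i => f (s^-1%g i)].
  have hK : {in predT, cancel h h'}.
    by move=> f _; apply/ffunP => i; rewrite !ffunE permKV.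
  have h'K : cancel h' h.
    by move=> f; apply/ffunP => i; rewrite !ffunE permK.
  rewrite Gml (reindex_onto h h') => [|f _]; last exact: h'K.
  apply: eq_big => [f|f _]; first by rewrite hK // eqxx.
  have -> : rowsub (h f) B = row_perm s (rowsub f B).
    by apply/matrixP => i j; rewrite !mxE ffunE.
  rewrite Galt mulrA [_ * (-1) ^+ _]mulrC; congr (_ * _ * _).
  by apply: eq_bigr => i _; rewrite ffunE.
rewrite -card_Sn mulr_natl -sum1_card -sumrMnr.
under eq_bigr => s _ do rewrite mulr1n (Gs s).
rewrite (eq_bigl xpredT); last by move=> s; rewrite inE.
rewrite exchange_big /=; apply: eq_bigr => f _.
rewrite -mulr_suml; congr (_ * _); apply: eq_bigr => s _; congr (_ * _).
by apply: eq_bigr => i _; rewrite !mxE.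
Qed.

Lemma row_multilinear_scale (G : 'M[R]_(p, m) -> R) (a : R) :
  row_multilinear G -> row_multilinear (fun M => a * G M).
Proof.
move=> Gml n A B; rewrite Gml mulr_sumr.
by apply: eq_bigr => f _; rewrite mulrCA.
Qed.

Lemma row_alternating_scale (G : 'M[R]_(p, m) -> R) (a : R) :
  row_alternating G -> row_alternating (fun M => a * G M).
Proof. by move=> Galt s M; rewrite Galt mulrCA. Qed.

End RowForms.

Lemma det_row_multilinear (R : comNzRingType) p :
  row_multilinear (@determinant R p).
Proof.
move=> n A B; rewrite /determinant.
under eq_bigr => s _.
  under eq_bigr => i _ do rewrite mxE.
  rewrite bigA_distr_bigA big_distrr /=; over.
rewrite exchange_big /=; apply: eq_bigr => f _.
rewrite big_distrr /=; apply: eq_bigr => s _.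
rewrite big_split /= mulrCA; congr (_ * (_ * _)).
by apply: eq_bigr => i _; rewrite mxE.
Qed.

Lemma det_row_alternating (R : comNzRingType) p :
  row_alternating (@determinant R p).
Proof. by move=> s M; rewrite row_permE det_mulmx det_perm. Qed.

Lemma det_col_mx_mul (R : comNzRingType) p q (D : 'M[R]_(q, p + q)) g M :
  \det (col_mx (g *m M) D) = \det g * \det (col_mx M D).
Proof.
have -> : col_mx (g *m M) D = block_mx g 0 0 1%:M *m col_mx M D.
  by rewrite mul_block_col !mul0mx mul1mx addr0 add0r.
by rewrite det_mulmx det_ublock det1 mulr1.
Qed.

(** With [q = 2] and [D] made of two rows of [Z] this form is a twistor coordinate. Only the first
    [p] factors of the Leibniz formula are expanded. *)
Lemma det_col_mx_row_multilinear (R : comNzRingType) p q (D : 'M[R]_(q, p + q)) :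
  row_multilinear (fun M : 'M[R]_(p, p + q) => \det (col_mx M D)).
Proof.
move=> n A B; rewrite /determinant.
under eq_bigr => s _.
  rewrite big_split_ord /=.
  under eq_bigr => i _ do rewrite col_mxEu mxE.
  rewrite bigA_distr_bigA big_distrl big_distrr /=; over.
rewrite exchange_big /=; apply: eq_bigr => f _.
rewrite big_distrr /=; apply: eq_bigr => s _.
rewrite big_split_ord big_split /= -!mulrA mulrCA; congr (_ * (_ * (_ * _))).
  by apply: eq_bigr => i _; rewrite col_mxEu mxE.
by apply: eq_bigr => i _; rewrite !col_mxEd.
Qed.

Lemma det_col_mx_row_alternating (R : comNzRingType) p q (D : 'M[R]_(q, p + q)) :
  row_alternating (fun M : 'M[R]_(p, p + q) => \det (col_mx M D)).
Proof. by move=> s M; rewrite row_permE det_col_mx_mul det_perm. Qed.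

Lemma det_colsub_perm (R : comNzRingType) p n (s : 'S_p) (f : 'I_p -> 'I_n)
    (A : 'M[R]_(p, n)) :
  \det (colsub (f \o s) A) = (-1) ^+ s * \det (colsub f A).
Proof.
rewrite -det_tr -[in RHS]det_tr -det_row_alternating; congr (\det _).
by apply/matrixP => i j; rewrite !mxE.
Qed.

Lemma row_form_rowsub_perm (R : comNzRingType) p m n (G : 'M[R]_(p, m) -> R)
    (s : 'S_p) (f : 'I_p -> 'I_n) (B : 'M[R]_(n, m)) :
  row_alternating G ->
  G (rowsub (f \o s) B) = (-1) ^+ s * G (rowsub f B).
Proof.
move=> Galt; rewrite -Galt; congr (G _).
by apply/matrixP => i j; rewrite !mxE.
Qed.

Lemma det_colsub_noninj (R : comNzRingType) p n (f : 'I_p -> 'I_n)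
    (A : 'M[R]_(p, n)) :
  ~~ injectiveb f -> \det (colsub f A) = 0.
Proof.
case/injectivePn => i [j ij fij].
rewrite -det_tr; apply: (determinant_alternate ij) => l.
by rewrite !mxE fij.
Qed.

(** Sending [i] to the number of [j] with [f j < f i] is a permutation; its inverse sorts [f]. *)
Lemma sorting_perm p n (f : 'I_p -> 'I_n) :
  injective f -> exists s : 'S_p, increasing (f \o s).
Proof.
move=> f_inj; pose r i := #|[set j | (f j < f i)%N]|.
have r_lt i : (r i < p)%N.
  rewrite -[X in (_ < X)%N](card_ord p) -cardsT; apply: proper_card.
  by apply/properP; split; [exact: finset.subsetT|exists i; rewrite ?inE ?ltnn].
have r_homo i j : (f i < f j)%N -> (r i < r j)%N.
  move=> fij; apply: proper_card; apply/properP; split.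
    by apply/fintype.subsetP => l; rewrite !inE => /ltn_trans; apply.
  by exists i; rewrite !inE ?ltnn.
pose ro i := Ordinal (r_lt i).
have ro_inj : injective ro.
  move=> i j /(congr1 val) /= rij; apply: f_inj; apply/val_inj => /=.
  by case: (ltngtP (f i) (f j)) => // /r_homo; rewrite rij ltnn.
exists (perm ro_inj)^-1%g => i j ij /=.
set a := _ i; set b := _ j.
have ra : val (ro a) = i by rewrite -[in RHS](permKV (perm ro_inj) i) [in RHS]permE.
have rb : val (ro b) = j by rewrite -[in RHS](permKV (perm ro_inj) j) [in RHS]permE.
case: (ltngtP (f a) (f b)) => [//|/r_homo|/val_inj/f_inj ab].
  by rewrite -[r b]/(val (ro b)) -[r a]/(val (ro a)) ra rb ltnNge ltnW.
by move: ij; rewrite -ra -rb ab ltnn.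
Qed.

Lemma increasing_inj p n (f : 'I_p -> 'I_n) : increasing f -> injective f.
Proof.
move=> fi i j /(congr1 val) fij; apply/val_inj.
by case: (ltngtP i j) => // /fi; rewrite /= fij ltnn.
Qed.

Section Positivity.
Variables (R : realFieldType) (p m n : nat) (G : 'M[R]_(p, m) -> R).
Variables (A : 'M[R]_(p, n)) (B : 'M[R]_(n, m)).
Hypothesis Gml : row_multilinear G.
Hypothesis Galt : row_alternating G.
Hypothesis A_ge0 : forall f : 'I_p -> 'I_n, increasing f -> 0 <= \det (colsub f A).
Hypothesis B_ge0 : forall f : 'I_p -> 'I_n, increasing f -> 0 <= G (rowsub f B).

(** Sorting [f] multiplies both factors by the same sign, so the hypotheses on increasing maps
    suffice; for a non-injective [f] the first factor is zero. *)
Let term_ge0 (f : 'I_p -> 'I_n) : 0 <= \det (colsub f A) * G (rowsub f B).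
Proof.
case: (boolP (injectiveb f)) => [/injectiveP|/det_colsub_noninj->]; last first.
  by rewrite mul0r.
case/sorting_perm => s fs.
have := mulr_ge0 (A_ge0 fs) (B_ge0 fs).
by rewrite det_colsub_perm row_form_rowsub_perm // mulrACA -signr_addb addbb mul1r.
Qed.

Lemma row_form_mulmx_ge0 : 0 <= G (A *m B).
Proof.
have p0 : 0 < (p`!)%:R :> R by rewrite ltr0n fact_gt0.
rewrite -(pmulr_rge0 _ p0) cauchy_binet_unordered //.
by apply: sumr_ge0 => f _; exact: term_ge0.
Qed.

Lemma row_form_mulmx_gt0 (f : 'I_p -> 'I_n) :
  0 < \det (colsub f A) -> 0 < G (rowsub f B) -> 0 < G (A *m B).
Proof.
have p0 : 0 < (p`!)%:R :> R by rewrite ltr0n fact_gt0.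
move=> Af Bf; rewrite -(pmulr_rgt0 _ p0) cauchy_binet_unordered //.
rewrite (bigD1 [ffun i => f i]) //=; apply: ltr_wpDr.
  by apply: sumr_ge0 => g _; exact: term_ge0.
have -> : colsub [ffun i => f i] A = colsub f A.
  by apply/matrixP => i j; rewrite !mxE ffunE.
have -> : rowsub [ffun i => f i] B = rowsub f B.
  by apply/matrixP => i j; rewrite !mxE ffunE.
exact: mulr_gt0.
Qed.

End Positivity.

(** Used to find a nonzero minor of a nonnegative matrix from one nonzero twistor coordinate. *)
Lemma row_form_mulmx_minor (R : comNzRingType) p m n (G : 'M[R]_(p, m) -> R)
    (A : 'M[R]_(p, n)) (B : 'M[R]_(n, m)) :
  row_multilinear G -> row_alternating G -> (p`!)%:R * G (A *m B) != 0 ->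
  exists2 f : 'I_p -> 'I_n, increasing f & \det (colsub f A) != 0.
Proof.
move=> Gml Galt; rewrite cauchy_binet_unordered // => S0.
have [f Af] : exists f : {ffun 'I_p -> 'I_n}, \det (colsub f A) != 0.
  apply/existsP; apply: contraNT S0; rewrite negb_exists => /forallP A0.
  by rewrite big1 // => f _; have := A0 f; rewrite negbK => /eqP->; rewrite mul0r.
have /injectiveP/sorting_perm[s fs] : injectiveb f.
  by apply: contraNT Af => /det_colsub_noninj->.
by exists (f \o s) => //; rewrite det_colsub_perm mulrI_eq0 //; exact/lreg_sign.
Qed.

(** * Vandermonde determinants and signs of unsorted minors *)

Section VandermondeSign.
Variables (R : realFieldType).

Definition nodes_mx N n (x : 'I_n -> R) : 'M[R]_(n, N) := \matrix_(i, j) x i ^+ j.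

Lemma det_nodes_mx N n (x : 'I_n -> R) (h : 'I_N -> 'I_n) :
  \det (rowsub h (nodes_mx N x)) =
  \prod_(i < N) \prod_(j < N | (i < j)%N) (x (h j) - x (h i)).
Proof.
rewrite -det_tr -[RHS](_ : \det (Vandermonde N (\row_i x (h i))) = _).
  by congr (\det _); apply/matrixP => i j; rewrite !mxE.
rewrite det_Vandermonde; apply: eq_bigr => i _; apply: eq_bigr => j _.
by rewrite !mxE.
Qed.

Lemma det_nodes_mx_gt0 N n (x : 'I_n -> R) (h : 'I_N -> 'I_n) :
  {homo x : i j / (i < j)%N >-> i < j} -> increasing h ->
  0 < \det (rowsub h (nodes_mx N x)).
Proof.
move=> xi hi; rewrite det_nodes_mx.
apply: prodr_gt0 => i _; apply: prodr_gt0 => j ij.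
by rewrite subr_gt0; apply/xi/hi.
Qed.

(* The sign of the sorting permutation of [h] is read off a Vandermonde
   determinant with the same row indices. *)
Lemma det_rowsub_sign N n (Z : 'M[R]_(n, N)) (h : 'I_N -> 'I_n) :
  (forall f : 'I_N -> 'I_n, increasing f -> 0 < \det (rowsub f Z)) ->
  injective h ->
  0 < \det (rowsub h Z) *
      \prod_(i < N) \prod_(j < N | (i < j)%N) ((h j)%:R - (h i)%:R).
Proof.
move=> Zgt0 /sorting_perm[s hs].
pose x (i : 'I_n) : R := i%:R.
have xi : {homo x : i j / (i < j)%N >-> i < j} by move=> i j; rewrite ltr_nat.
have := mulr_gt0 (Zgt0 _ hs) (det_nodes_mx_gt0 xi hs).
rewrite !(row_form_rowsub_perm _ _ _ (@det_row_alternating _ _)).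
by rewrite mulrACA -signr_addb addbb mul1r det_nodes_mx.
Qed.

End VandermondeSign.

(** * Signs of the brackets formed by rows of a positive matrix *)

Lemma prod_pairs_append2 (R : comNzRingType) k (F : 'I_(k + 2) -> 'I_(k + 2) -> R) :
  \prod_(i < k + 2) \prod_(j < k + 2 | (i < j)%N) F i j =
  (\prod_(a < k) \prod_(b < k | (a < b)%N) F (lshift 2 a) (lshift 2 b)) *
  (\prod_(a < k) (F (lshift 2 a) (rshift k 0) * F (lshift 2 a) (rshift k 1))) *
  F (rshift k 0) (rshift k 1).
Proof.
rewrite big_split_ord -big_split /=; congr (_ * _).
  apply: eq_bigr => a _.
  rewrite big_mkcond big_split_ord /= -big_mkcond /=; congr (_ * _).
  rewrite !big_ord_recl big_ord0 /= !ltn_addr // mulr1.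
  by congr (_ * F _ (rshift _ _)); apply/val_inj.
have row_r (x : 'I_2) : \prod_(j < k + 2 | (k + x < j)%N) F (rshift k x) j =
    \prod_(b < 2 | (x < b)%N) F (rshift k x) (rshift k b).
  rewrite big_mkcond big_split_ord /= big1 ?mul1r => [|a _]; last first.
    by rewrite ltnNge ltnW // (leq_trans (ltn_ord a)) ?leq_addr.
  by rewrite [RHS]big_mkcond; apply: eq_bigr => b _; rewrite /= ltn_add2l.
under eq_bigr => x _ do rewrite row_r.
rewrite !big_ord_recl big_ord0 mulr1 ![\prod_(b < 2 | _) _]big_mkcond.
rewrite !big_ord_recl !big_ord0 /= !mul1r !mulr1.
by congr (F (rshift _ _) (rshift _ _)); apply/val_inj.
Qed.

Section Brackets.
Variables (R : realType) (n k : nat) (Z : 'M[R]_(n, k + 2)).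
Hypothesis Zgt0 : Mat_gt0 Z.

(** The Vandermonde product of the sequence [f], [i], [j] without the factors internal to [f], which
    are positive when [f] is increasing. *)
Let pair_sign (f : 'I_k -> 'I_n) (i j : 'I_n) : R :=
  (\prod_a ((i%:R - (f a)%:R) * (j%:R - (f a)%:R))) * (j%:R - i%:R).

Lemma bracket_rowsub_sign (f : 'I_k -> 'I_n) (i j : 'I_n) :
  increasing f -> i != j -> (forall a, (f a != i) && (f a != j)) ->
  0 < bracket (rowsub f Z) (row i Z) (row j Z) * pair_sign f i j.
Proof.
move=> fi ij fij.
pose h (x : 'I_(k + 2)) :=
  match fintype.split x with inl a => f a | inr b => if b == 0 then i else j end.
have hl a : h (lshift 2 a) = f a by rewrite /h (unsplitK (inl a)).
have hr b : h (rshift k b) = if b == 0 then i else j by rewrite /h (unsplitK (inr b)).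
have ord2 (a : 'I_2) : a <> 0 -> a = 1.
  by case: a => [[|[|?]] ?] // H; [case: H; exact: val_inj|exact: val_inj].
have h_inj : injective h.
  move=> x y; rewrite -[x]splitK -[y]splitK.
  have f_inj := increasing_inj fi.
  case: (fintype.split x) (fintype.split y) => a [] b /=; rewrite ?hl ?hr.
  - by move/f_inj->.
  - by have /andP[/negPf A /negPf B] := fij a; case: ifP => _ /eqP; rewrite ?A ?B.
  - by have /andP[/negPf A /negPf B] := fij b; case: ifP => _ /esym/eqP; rewrite ?A ?B.
  - case: (a =P 0) => [->|]; case: (b =P 0) => [->|] //.
    + by move=> _ E; rewrite E eqxx in ij.
    + by move=> _ E; rewrite E eqxx in ij.
    + by move=> b0 a0 _; rewrite (ord2 a) // (ord2 b).
have -> : bracket (rowsub f Z) (row i Z) (row j Z) = \det (rowsub h Z).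
  congr (\det _); apply/matrixP => x y; rewrite !mxE /h.
  case: fintype.split => a; rewrite !mxE // /=.
  by case: (splitP a) => b /=; rewrite ord1 !mxE => ab; congr (Z _ _);
     rewrite -(inj_eq val_inj) /= ab.
have := det_rowsub_sign Zgt0 h_inj.
rewrite prod_pairs_append2 !hr /=.
under eq_bigr => a _ do under eq_bigr => b _ do rewrite !hl.
under [X in _ * (_ * X * _)]eq_bigr => a _ do rewrite hl.
rewrite -mulrA mulrCA pmulr_rgt0 //.
apply: prodr_gt0 => a _; apply: prodr_gt0 => b ab.
by rewrite subr_gt0 ltr_nat; apply: fi.
Qed.

Lemma bracket_rowsub_eq0 (f : 'I_k -> 'I_n) (i j : 'I_n) a :
  (f a == i) || (f a == j) ->
  bracket (rowsub f Z) (row i Z) (row j Z) = 0.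
Proof.
have ne (b : 'I_2) : lshift 2 a != rshift k b by rewrite eq_lrshift.
case/orP => /eqP <-; rewrite /bracket.
  apply: determinant_alternate; first exact: (ne (lshift 1 (ord0 : 'I_1))).
  move=> l; apply: (etrans (col_mxEu _ _ _ _)); apply: esym.
  apply: (etrans (col_mxEd _ _ _ _)); apply: (etrans (col_mxEu _ _ _ _)).
  by rewrite !mxE.
apply: determinant_alternate; first exact: (ne (rshift 1 (ord0 : 'I_1))).
move=> l; apply: (etrans (col_mxEu _ _ _ _)); apply: esym.
  apply: (etrans (col_mxEd _ _ _ _)); apply: (etrans (col_mxEd _ _ _ _)).
  by rewrite !mxE.
Qed.

Lemma bracket_rowsub_ge0 (f : 'I_k -> 'I_n) (i j : 'I_n) (e : R) :
  increasing f -> i != j ->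
  ((forall a, (f a != i) && (f a != j)) -> 0 < e * pair_sign f i j) ->
  0 <= e * bracket (rowsub f Z) (row i Z) (row j Z).
Proof.
move=> fi ij es.
case: (boolP [forall a, (f a != i) && (f a != j)]) => [/forallP fij|]; last first.
  rewrite negb_forall => /existsP[a]; rewrite negb_and !negbK.
  by move=> /bracket_rowsub_eq0->; rewrite mulr0.
have := mulr_gt0 (bracket_rowsub_sign fi ij fij) (es fij).
(* In the product of the two inequalities [pair_sign] is squared, and it is nonzero by [es], so it
   can be cancelled. *)
rewrite mulrACA -expr2 [_ * e]mulrC pmulr_lgt0; first exact: ltW.
rewrite exprn_even_gt0 //=; apply: contraTneq (es fij) => ->.
by rewrite mulr0 ltxx.
Qed.

(** No index lies strictly between [i] and [i + 1], so the two factors of [pair_sign] attached to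
    each [f a] have the same sign. *)
Lemma bracket_rowsub_succ_ge0 (f : 'I_k -> 'I_n) (i j : 'I_n) :
  increasing f -> j = i.+1 :> nat ->
  0 <= bracket (rowsub f Z) (row i Z) (row j Z).
Proof.
move=> fi ji; rewrite -[X in _ <= X]mul1r; apply: bracket_rowsub_ge0 => //.
  by apply/eqP => ij; move: ji; rewrite ij; lia.
move=> fij; rewrite mul1r mulr_gt0 //; last by rewrite subr_gt0 ltr_nat ji.
apply: prodr_gt0 => a _; have := fij a; rewrite -!(inj_eq val_inj) /= ji => /andP[f1 f2].
have [fa|fa|fa] := ltngtP (f a) i; last by rewrite fa eqxx in f1.
  by rewrite mulr_gt0 // subr_gt0 ltr_nat //; lia.
by rewrite nmulr_rgt0 subr_lt0 ltr_nat //; lia.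
Qed.

(** Each [f a] lies strictly between the first and the last index, so it contributes one negative
    factor; the factor [j - i] is the last of the [k + 1] signs. *)
Lemma bracket_rowsub_last_ge0 (f : 'I_k -> 'I_n) (i j : 'I_n) :
  (1 < n)%N -> increasing f -> i.+1 = n -> j = 0%N :> nat ->
  0 <= (-1) ^+ (k + 1) * bracket (rowsub f Z) (row i Z) (row j Z).
Proof.
move=> n1 fi iN j0; apply: bracket_rowsub_ge0 => //.
  by apply/eqP => ij; move: iN; rewrite ij j0; lia.
move=> fij; rewrite /pair_sign exprD expr1 mulrN1.
have -> : \prod_a ((i%:R - (f a)%:R) * (j%:R - (f a)%:R)) =
   (-1) ^+ k * \prod_a ((i%:R - (f a)%:R) * ((f a)%:R - j%:R)) :> R.
  rewrite -[X in (-1) ^+ X](card_ord k) -prodr_const -big_split /=.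
  by apply: eq_bigr => a _; ring.
set X := \prod_a _.
have -> : - (-1) ^+ k * ((-1) ^+ k * X * (j%:R - i%:R)) =
    ((-1) ^+ k) ^+ 2 * X * (i%:R - j%:R) :> R by ring.
rewrite -exprM mulnC exprM sqrrN !expr1n mul1r.
rewrite mulr_gt0 //; last by rewrite subr_gt0 ltr_nat; lia.
apply: prodr_gt0 => a _; have := fij a; rewrite -!(inj_eq val_inj) /= => /andP[f1 f2].
have fa := ltn_ord (f a).
by rewrite mulr_gt0 // subr_gt0 ltr_nat; lia.
Qed.

(** Both factors attached to [f a] are negative. The strict sign later shows that the constructed
    preimage has an image of full rank. *)
Lemma bracket_rowsub01_gt0 (f : 'I_k -> 'I_n) (i j : 'I_n) :
  increasing f -> i = 0%N :> nat -> j = 1%N :> nat -> (forall a, 1 < f a)%N ->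
  0 < bracket (rowsub f Z) (row i Z) (row j Z).
Proof.
move=> fi i0 j1 f2.
have ij : i != j by apply/eqP => ij; move: j1; rewrite -ij i0.
have fij a : (f a != i) && (f a != j).
  by have := f2 a; rewrite -!(inj_eq val_inj) /= i0 j1; lia.
have := bracket_rowsub_sign fi ij fij; rewrite pmulr_lgt0 //.
rewrite mulr_gt0 //; last by rewrite subr_gt0 ltr_nat; lia.
apply: prodr_gt0 => a _; have fa2 := f2 a.
by rewrite nmulr_rgt0 subr_lt0 ltr_nat; lia.
Qed.

End Brackets.

(** * Determinants of matrices with staircase support *)

Section Staircase.
Variables (R : comNzRingType) (K : nat).

(** Both [s] and its inverse are increasing, and an increasing self-map [f] satisfies [i <= f i]. *)
Lemma increasing_perm_id (s : 'S_K) : increasing s -> s = 1%g.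
Proof.
have ge_id (f : 'I_K -> 'I_K) : increasing f -> forall i : 'I_K, (i <= f i)%N.
  move=> fi [i iK] /=; elim: i iK => // i IH iK.
  exact: leq_ltn_trans (IH (ltnW iK)) (fi (Ordinal (ltnW iK)) (Ordinal iK) (ltnSn i)).
move=> si.
have Vi : increasing (s^-1)%g.
  move=> i j ij; case: (ltngtP (s^-1 i)%g (s^-1 j)%g) => [//|/si|/val_inj/perm_inj E].
    by rewrite !permKV ltnNge (ltnW ij).
  by rewrite E ltnn in ij.
apply/permP => i; rewrite perm1; apply/val_inj/eqP.
by rewrite eqn_leq (ge_id _ si) andbT; have := ge_id _ Vi (s i); rewrite permK.
Qed.

(** Row [i] is supported on the labels [c i] and [c i + 1], and windows of distinct rows share at
    most an endpoint. A permutation contributing to the determinant is therefore increasing, hence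
    the identity. *)
Lemma det_staircase (c l : 'I_K -> nat) (B : 'M[R]_K) :
  {homo c : i j / (i < j)%N} -> {homo l : i j / (i < j)%N} ->
  (forall i j, B i j != 0 -> (c i <= l j <= (c i).+1)%N) ->
  \det B = \prod_i B i i.
Proof.
move=> ci li Bcl; rewrite /determinant (bigD1 1%g) //= odd_perm1 mul1r.
rewrite [X in _ + X]big1 ?addr0 => [|s sN1].
  by apply: eq_bigr => i _; rewrite perm1.
case: (boolP [exists i, B i (s i) == 0]) => [/existsP[i /eqP Bi]|].
  by rewrite (bigD1 i) //= Bi mul0r mulr0.
rewrite negb_exists => /forallP Bs; case/eqP: sN1; apply: increasing_perm_id.
move=> i j ij; have /andP[_ hi] := Bcl _ _ (Bs i); have /andP[hj _] := Bcl _ _ (Bs j).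
have lij : (l (s i) <= l (s j))%N by apply: leq_trans hi (leq_trans (ci _ _ ij) hj).
case: (ltngtP (s i) (s j)) => [//|/li|/val_inj/perm_inj E]; first by rewrite ltnNge lij.
by rewrite E ltnn in ij.
Qed.

End Staircase.

(** * Signs of the sine and of a polynomial with the same zeros *)

Section Trigonometry.
Variable R : realType.
Implicit Types x : R.

Lemma sin_addn_pi x m : sin (x + m%:R * pi) = (-1) ^+ m * sin x.
Proof.
elim: m => [|m IH]; first by rewrite mul0r addr0 mul1r.
by rewrite -natr1 mulrDl mul1r addrA sinDpi IH exprS mulN1r mulNr.
Qed.

Lemma sin_subn_pi x m : sin (x - m%:R * pi) = (-1) ^+ m * sin x.
Proof.
rewrite -[x in RHS](subrK (m%:R * pi)) sin_addn_pi mulrA -expr2.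
by rewrite -exprM mulnC exprM sqrrN !expr1n mul1r.
Qed.

Lemma sin_le0_Npi x : - pi <= x <= 0 -> sin x <= 0.
Proof. by move=> /andP[a b]; rewrite -oppr_ge0 -sinN sin_ge0_pi // oppr_ge0 b lerNl. Qed.

Lemma sin_lt0_Npi x : - pi < x < 0 -> sin x < 0.
Proof. by move=> /andP[a b]; rewrite -oppr_gt0 -sinN sin_gt0_pi // oppr_gt0 b ltrNl. Qed.

Lemma sin_le0_2pi x : pi <= x <= pi *+ 2 -> sin x <= 0.
Proof.
move=> /andP[a b]; rewrite -[x](subrK pi) sinDpi oppr_le0 sin_ge0_pi //.
by rewrite subr_ge0 a lerBlDr -mulr2n.
Qed.

(** On this interval the sine and the polynomial change sign at the same points. The constant
    depends on [x]; only its positivity matters, since it becomes a row scaling. *)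
Lemma sin_vs_poly K x : 0 <= x < K%:R * pi ->
  exists2 c : R, 0 < c &
    (-1) ^+ K.+1 * sin x = c * \prod_(m < K) (x - m%:R * pi).
Proof.
have pi0 := pi_gt0 R.
elim: K => [|K IH] /andP[x0 xK].
  by rewrite mul0r in xK; have := le_lt_trans x0 xK; rewrite ltxx.
have [xK'|xK'] := ltrP x (K%:R * pi).
  case: IH => [|c c0 E]; first by rewrite x0 xK'.
  (* The new factor [x - K pi] is negative: its absolute value is absorbed in the constant, its sign
     in the power of [-1]. *)
  exists (c / (K%:R * pi - x)); first by rewrite divr_gt0 // subr_gt0.
  have d : K%:R * pi - x != 0 by rewrite subr_eq0 gt_eqF.
  rewrite big_ord_recr /= exprS -mulrA E mulN1r.
  by rewrite -[x - K%:R * pi]opprB !mulrN mulrACA mulVf // mulr1.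
have sK : (-1) ^+ K.+2 * sin x = sin (x - K%:R * pi).
  by rewrite sin_subn_pi !exprS !mulN1r opprK.
have := xK'; rewrite le_eqVlt => /predU1P[xE|xK''].
  exists 1 => //; rewrite sK -xE subrr sin0 big_ord_recr /= subrr.
  by rewrite !mulr0.
have P0 : 0 < \prod_(m < K.+1) (x - m%:R * pi).
  apply: prodr_gt0 => m _; rewrite subr_gt0; apply: le_lt_trans xK''.
  by rewrite ler_pM2r // ler_nat -ltnS.
exists ((-1) ^+ K.+2 * sin x / \prod_(m < K.+1) (x - m%:R * pi)).
  rewrite divr_gt0 // sK sin_gt0_pi // subr_gt0 xK'' /=.
  by move: xK; rewrite -natr1 mulrDl mul1r; lra.
by rewrite divfK // gt_eqF.
Qed.

End Trigonometry.

(** * Nonnegative matrices and kernels read off the swept angles *)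

Lemma ord2P (j : 'I_2) : j = 0 \/ j = 1.
Proof. by case: j => [[|[|//]] jP]; [left|right]; apply/val_inj. Qed.

Definition det2 (R : comNzRingType) (u v : 'rV[R]_2) : R :=
  u 0 0 * v 0 1 - u 0 1 * v 0 0.

Lemma det_col_mx2 (R : comNzRingType) (u v : 'rV[R]_2) :
  \det (col_mx u v : 'M[R]_2) = det2 u v.
Proof.
rewrite (expand_det_row _ ord0) !big_ord_recl big_ord0 /cofactor !det_mx11 /=.
rewrite !mxE /= expr0 expr1.
have -> : fintype.split (ord0 : 'I_(1 + 1)) = inl ord0.
  by case: splitP => // j _; rewrite ord1.
have -> : fintype.split (lift ord0 ord0 : 'I_(1 + 1)) = inr ord0.
  by case: splitP => j //= H; rewrite ord1 // in H *.
rewrite /det2 /=.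
have -> : lift 0 0 = 1 :> 'I_2 by apply/val_inj.
have -> : lift 1 0 = 0 :> 'I_2 by apply/val_inj.
by rewrite mul1r mulN1r mulrN addr0.
Qed.

Lemma steps_increasing (R : realFieldType) n (phi : nat -> R) (b : R) :
  (forall i, (i < n)%N -> 0 < phi i.+1 - phi i < b) ->
  forall i j, (i < j)%N -> (j <= n)%N -> phi i < phi j.
Proof.
move=> steps i; elim=> // j IH; rewrite ltnS leq_eqVlt => /predU1P[->|ij] jn.
  by have /andP[] := steps _ jn; rewrite subr_gt0.
apply: lt_trans (IH ij (ltnW jn)) _.
by have /andP[] := steps _ jn; rewrite subr_gt0.
Qed.

(* [phi i] is the angle swept from [z_0] to [z_i]; row [m] of the matrix is the
   linear relation between [z_0], [z_i] and [z_(i+1)] at the step [i] where the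
   angle crosses [(m + 1) pi]. *)
Lemma crossing_matrix (R : realType) n K (z : 'M[R]_(n.+2, 2))
    (phi : nat -> R) (r : 'I_n.+2 -> R) :
  phi 0%N = 0 ->
  (forall i, (i < n.+1)%N -> 0 < phi i.+1 - phi i < pi) ->
  (forall i, 0 < r i) ->
  (forall i : 'I_n.+2, det2 (row ord0 z) (row i z) = r i * sin (phi i)) ->
  (forall i j : 'I_n.+2, j = i.+1 :> nat -> 0 < det2 (row i z) (row j z)) ->
  K%:R * pi <= phi n.+1 ->
  exists (C : 'M[R]_(K, n.+2)) (f : 'I_K -> 'I_n.+2),
    [/\ forall g : 'I_K -> 'I_n.+2, increasing g -> 0 <= \det (colsub g C),
        C *m z = 0, increasing f, forall m, (1 < f m)%N
      & 0 < \det (colsub f C)].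
Proof.
move=> phi0 steps r0 wE d0 phiK; have pi0 := pi_gt0 R.
have phi_lt := steps_increasing steps.
(* [c m] precedes the first index at which [phi] reaches [(m + 1) pi]. It is not 0, because the
   first step is shorter than [pi]. *)
have /fin_all_exists[c cP] (m : 'I_K) : exists i : 'I_n.+1,
    (0 < i)%N && (phi i < m.+1%:R * pi <= phi i.+1).
  have ex : exists j, m.+1%:R * pi <= phi j.
    by exists n.+1; apply: le_trans phiK; rewrite ler_pM2r // ler_nat.
  case: (ex_minnP ex) => [[|j] jP jmin].
    by move: jP; rewrite phi0 leNgt mulr_gt0.
  have jn : (j < n.+1)%N.
    by apply: jmin; apply: le_trans phiK; rewrite ler_pM2r // ler_nat.
  have j_lt : phi j < m.+1%:R * pi.
    by rewrite ltNge; apply/negP => /jmin; rewrite ltnn.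
  exists (Ordinal jn); rewrite /= j_lt jP !andbT lt0n; apply/eqP => j0.
  have := steps 0%N isT; rewrite phi0 subr0 => /andP[_]; apply/negP; rewrite -leNgt.
  rewrite j0 in jP; apply: le_trans jP.
  by rewrite -[X in X <= _]mul1r ler_pM2r // ler1n.
(* A step shorter than [pi] cannot cross two multiples of [pi]. *)
have c_homo : {homo (fun m => c m : nat) : i j / (i < j)%N}.
  move=> i j ij; rewrite ltnNge; apply/negP => cji.
  have /and3P[_ lo _] := cP i; have /and3P[_ _ hi] := cP j.
  have := steps _ (ltn_ord (c j)) => /andP[_].
  have ij1 : i.+1%:R * pi + pi <= j.+1%:R * pi :> R.
    by rewrite -{2}[pi]mul1r -mulrDl natr1 ler_pM2r // ler_nat.
  have : phi (c j) <= phi (c i).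
    move: cji; rewrite leq_eqVlt => /predU1P[->//|/phi_lt h].
    by apply/ltW/h/ltnW.
  lra.
pose w (i : 'I_n.+2) := det2 (row ord0 z) (row i z).
pose lo (m : 'I_K) : 'I_n.+2 := widen_ord (leqnSn _) (c m).
pose hi (m : 'I_K) : 'I_n.+2 := lift ord0 (c m).
have wlo (m : 'I_K) : 0 < (-1) ^+ m * w (lo m).
  rewrite /w wE mulrCA mulr_gt0 //= -sin_subn_pi sin_gt0_pi //.
  have /and3P[_ a b] := cP m; have /andP[_] := steps _ (ltn_ord (c m)).
  by move: a b; rewrite -natr1 mulrDl mul1r; lra.
have whi (m : 'I_K) : (-1) ^+ m * w (hi m) <= 0.
  rewrite /w wE mulrCA pmulr_rle0 //= -sin_subn_pi sin_le0_2pi //.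
  have /and3P[_ a b] := cP m; have /andP[_] := steps _ (ltn_ord (c m)).
  by move: a b; rewrite /bump /= add1n -natr1 mulrDl mul1r mulr2n; lra.
pose d m := det2 (row (lo m) z) (row (hi m) z).
have d_gt0 m : 0 < d m by apply: d0.
(* The row is the identity [det2 b c *: a - det2 a c *: b + det2 a b *: c = 0] for [a], [b], [c] the
   rows [0], [lo m], [hi m] of [z]. The sign makes all entries outside column 0 nonnegative. *)
pose C : 'M[R]_(K, n.+2) := \matrix_(m, j) ((-1) ^+ m *
  (d m * (j == ord0)%:R - w (hi m) * (j == lo m)%:R + w (lo m) * (j == hi m)%:R)).
have lo0 m : lo m != ord0.
  by have /and3P[+ _ _] := cP m; rewrite -(inj_eq val_inj) /= lt0n.
have hi0 m : hi m != ord0 by [].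
have lohi m : hi m != lo m by rewrite -(inj_eq val_inj) /= /bump /= add1n; lia.
have C_ge0 m j : j != ord0 -> 0 <= C m j.
  move=> j0; rewrite mxE (negPf j0) mulr0 add0r mulrDr mulrN !mulrA -mulNr.
  by rewrite addr_ge0 // mulr_ge0 ?ler0n // ?oppr_ge0 ?whi // ltW.
have C_supp m j : j != ord0 -> C m j != 0 -> (c m <= j <= (c m).+1)%N.
  move=> j0; rewrite mxE (negPf j0) mulr0 add0r.
  case: (eqVneq j (lo m)) => [->|_] /=; first by rewrite leqnn leqnSn.
  case: (eqVneq j (hi m)) => [->|_] /=; first by rewrite /bump /= add1n leqnn leqnSn.
  by rewrite !mulr0 oppr0 addr0 mulr0 eqxx.
(* Minors avoiding column 0 have staircase support. The row selection [h] is there for the cofactors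
   of column 0. *)
have minor_noz L (h : 'I_L -> 'I_K) (g : 'I_L -> 'I_n.+2) :
    increasing h -> increasing g -> (forall l, g l != ord0) ->
    \det (mxsub h g C) = \prod_l C (h l) (g l).
  move=> hi_h gi g0.
  rewrite (@det_staircase _ _ (fun l => c (h l)) (fun l => g l)) //.
  - by apply: eq_bigr => l _; rewrite mxE.
  - by move=> i j ij; apply: c_homo; apply: hi_h.
  - by move=> i j; rewrite mxE; apply: C_supp.
exists C, hi; split => //.
- move=> g gi.
  have id_incr : increasing (@id 'I_K) by [].
  have noz : (forall l, g l != ord0) -> 0 <= \det (colsub g C).
    by move=> g0; rewrite (minor_noz K id g) //; apply: prodr_ge0 => l _; apply: C_ge0.
  case: (boolP [forall l, g l != ord0]) => [/forallP //|].
  rewrite negb_forall => /existsP[l0]; rewrite negbK => /eqP g0.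
  have l00 : l0 = 0%N :> nat.
    case: (posnP l0) => // l0_gt0; have K0 := leq_ltn_trans (leq0n l0) (ltn_ord l0).
    by have := gi (Ordinal K0) l0 l0_gt0; rewrite g0.
  have g0S l : g (lift l0 l) != ord0.
    have : (g l0 < g (lift l0 l))%N by apply: gi; rewrite /= /bump l00.
    by rewrite g0 -(inj_eq val_inj) /= lt0n.
  (* Column 0 can only come first in [g]; its entries [(-1)^m d m] cancel the signs of the
     cofactors. *)
  rewrite (expand_det_col _ l0); apply: sumr_ge0 => m _.
  rewrite mxE g0 mxE eqxx ![ord0 == _]eq_sym (negPf (lo0 m)) (negPf (hi0 m)).
  rewrite !mulr0 subr0 addr0 mulr1 /cofactor l00 addn0 mulrACA -expr2 -exprM mulnC.
  rewrite exprM sqrrN !expr1n mul1r mulr_ge0 ?(ltW (d_gt0 m)) //.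
  have -> : row' m (col' l0 (colsub g C)) = mxsub (lift m) (g \o lift l0) C.
    by apply/matrixP => i j; rewrite !mxE.
  rewrite minor_noz //.
  + by apply: prodr_ge0 => l _; apply: C_ge0; apply: g0S.
  + by move=> i j ij; rewrite /= /bump; case: leqP; case: leqP; lia.
  + by move=> i j ij; apply: gi; rewrite /= /bump l00 /= !add1n.
- apply/row_matrixP => m; rewrite row_mul row0; apply/rowP => j.
  rewrite !mxE.
  pose e (x : 'I_n.+2) := (-1) ^+ m * z x j.
  transitivity (d m * e ord0 - w (hi m) * e (lo m) + w (lo m) * e (hi m)).
    rewrite (bigD1 ord0) //= (bigD1 (lo m)) ?lo0 //= (bigD1 (hi m)) /=; last first.
      by rewrite ?hi0 lohi.
    rewrite big1 => [|x /andP[/andP[x0 x1] x2]]; last first.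
      by rewrite !mxE (negPf x0) (negPf x1) (negPf x2) !mulr0 subrr addr0 mulr0 mul0r.
    rewrite !mxE !eqxx ![ord0 == _]eq_sym (negPf (lo0 m)) (negPf (hi0 m)).
    by rewrite [lo m == hi m]eq_sym (negPf (lohi m)) /= /e; ring.
  rewrite /d /w /e /det2 !mxE.
  by case: (ord2P j) => ->; ring.
- by move=> m; rewrite /= /bump /= add1n ltnS; have /and3P[] := cP m.
(* The columns [hi] are chosen because their diagonal entries are strictly positive; those in the
   columns [lo] vanish when [phi] hits a multiple of [pi] exactly. *)
- rewrite (minor_noz K id hi) //.
  apply: prodr_gt0 => m _.
  rewrite mxE (negPf (hi0 m)) (negPf (lohi m)) eqxx !mulr0 subrr add0r mulr1.
  exact: wlo.
Qed.

(* If [phi] stays below [(k - 1) pi], then [w] is in the column span of a matrix with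
   positive minors, namely [\matrix_(i, m) c i * phi i ^+ m] with [c > 0]. *)
Lemma nonneg_kernel_angle (R : realType) n k (C : 'M[R]_(k, n))
    (w : 'cV[R]_n) (phi r : 'I_n -> R) (f : 'I_k -> 'I_n) :
  (0 < k)%N ->
  (forall g : 'I_k -> 'I_n, increasing g -> 0 <= \det (colsub g C)) ->
  increasing f -> 0 < \det (colsub f C) ->
  C *m w = 0 ->
  {homo phi : i j / (i < j)%N >-> i < j} ->
  (forall i, 0 < r i) -> (forall i, w i 0 = r i * sin (phi i)) ->
  (forall i, 0 <= phi i < k.-1%:R * pi) -> False.
Proof.
case: k C f => // k C f _ C_ge0 f_incr Cf Cw phi_incr r0 wE phi_bd.
have /fin_all_exists2[c c0 cE] i := sin_vs_poly (phi_bd i).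
(* After the case analysis [k] is one less than the number of rows, so [q] has degree [k] and
   [k + 1] coefficients, collected in [s]. *)
pose q : {poly R} := \prod_(m < k) ('X - (m%:R * pi)%:P).
have sq : size q = k.+1.
  rewrite size_prod_XsubC.
  by rewrite /index_enum -enumT size_enum_ord.
pose T := \matrix_(i < n, m < k.+1) (r i * c i * phi i ^+ m).
pose s : 'cV[R]_k.+1 := \col_m q`_m.
have Ts : T *m s = (-1) ^+ k.+1 *: w.
  apply/colP => i; rewrite !mxE wE mulrCA cE mulrA.
  rewrite -[\prod_(m < k) _](_ : q.[phi i] = _); last first.
    by rewrite horner_prod; apply: eq_bigr => m _; rewrite !hornerE.
  rewrite (horner_coef_wide (n := k.+1)) ?sq // mulr_sumr.
  by apply: eq_bigr => m _; rewrite !mxE; ring.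
have T_gt0 (g : 'I_k.+1 -> 'I_n) : increasing g -> 0 < \det (rowsub g T).
  move=> gi; have -> : rowsub g T =
      diag_mx (\row_i (r (g i) * c (g i))) *m rowsub g (nodes_mx k.+1 phi).
    by apply/matrixP => i j; rewrite mul_diag_mx !mxE.
  rewrite det_mulmx det_diag mulr_gt0 ?det_nodes_mx_gt0 //.
  by apply: prodr_gt0 => i _; rewrite mxE mulr_gt0.
have CT : 0 < \det (C *m T).
  have T_ge0 g gi := ltW (T_gt0 g gi).
  exact: (row_form_mulmx_gt0 (@det_row_multilinear _ _) (@det_row_alternating _ _)
    C_ge0 T_ge0 Cf (T_gt0 f f_incr)).
have : C *m T *m s = 0 by rewrite -mulmxA Ts -scalemxAr Cw scaler0.
have CTu : C *m T \in unitmx by rewrite unitmxE unitfE gt_eqF.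
move/(congr1 (mulmx (invmx (C *m T)))); rewrite mulKmx // mulmx0.
(* Invertibility of [C *m T] forces [s = 0], but the last entry of [s] is the leading coefficient 1
   of [q]. *)
move/colP/(_ ord_max); rewrite !mxE /= => qk.
have : lead_coef q = 1 by apply/monicP; exact: monic_prod_XsubC.
by rewrite lead_coefE sq qk => /eqP; rewrite eq_sym oner_eq0.
Qed.

(** * Polar coordinates and the angle between two plane vectors *)

Section PolarCoordinates.
Local Open Scope classical_set_scope.
Variable R : realType.
Implicit Types (u v : 'rV[R]_2) (s t : R).

Definition enorm u := Num.sqrt (u 0 0 ^+ 2 + u 0 1 ^+ 2).

Definition dot2 u v := u 0 0 * v 0 0 + u 0 1 * v 0 1.

Lemma enorm_sq u : enorm u ^+ 2 = u 0 0 ^+ 2 + u 0 1 ^+ 2.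
Proof. by rewrite sqr_sqrtr // addr_ge0 ?sqr_ge0. Qed.

Lemma enorm_ge0 u : 0 <= enorm u.
Proof. exact: sqrtr_ge0. Qed.

Lemma enorm_eq0 u : enorm u = 0 -> u 0 0 = 0 /\ u 0 1 = 0.
Proof.
move=> u0; have := enorm_sq u; rewrite u0 expr0n => /esym/eqP.
by rewrite paddr_eq0 ?sqr_ge0 // !sqrf_eq0 => /andP[/eqP ? /eqP ?].
Qed.

Lemma enorm_gt0_det2 u v : det2 u v != 0 -> 0 < enorm u.
Proof.
move=> d0; rewrite lt_neqAle enorm_ge0 andbT eq_sym.
by apply: contraNneq d0 => /enorm_eq0[z0 z1]; rewrite /det2 z0 z1 !mul0r subrr.
Qed.

Lemma normalizeP u t : normalize u = unit_circle t <->
  [/\ 0 < enorm u, u 0 0 = enorm u * cos t & u 0 1 = enorm u * sin t].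
Proof.
split=> [E|[u0 uc us]].
  have /rowP E0 := E; have := E0 0; have := E0 1; rewrite !mxE /= -/(enorm u) => Es Ec.
  have u0 : 0 < enorm u.
    rewrite lt_neqAle enorm_ge0 andbT; apply/eqP => u0.
    have := cos2Dsin2 t; rewrite -Es -Ec -u0 invr0 !mul0r expr0n /= addr0.
    by move/esym/eqP; rewrite oner_eq0.
  by split=> //; rewrite -?Es -?Ec mulrA mulfV ?mul1r // gt_eqF.
apply/rowP => j; rewrite !mxE -/(enorm u).
have un : enorm u != 0 by rewrite gt_eqF.
by case: (ord2P j) => -> /=; rewrite ?uc ?us mulrA mulVf ?mul1r.
Qed.

Lemma det2_polar u v s t :
  normalize u = unit_circle s -> normalize v = unit_circle t ->
  det2 u v = enorm u * enorm v * sin (t - s).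
Proof.
move=> /normalizeP[_ u0 u1] /normalizeP[_ v0 v1].
by rewrite sinB /det2 u0 u1 v0 v1; ring.
Qed.

(* The half-angle formula for the angle in [(- pi, pi)] from [u] to [v]; it is
   continuous off the ray opposite to [u], where the denominator vanishes. *)
Definition angle u v := 2 * atan (det2 u v / (enorm u * enorm v + dot2 u v)).

Lemma det2xx u : det2 u u = 0.
Proof. by rewrite /det2; ring. Qed.

Lemma anglexx u : angle u u = 0.
Proof. by rewrite /angle det2xx mul0r atan0 mulr0. Qed.

Lemma lagrange2 u v : (enorm u * enorm v) ^+ 2 = dot2 u v ^+ 2 + det2 u v ^+ 2.
Proof. by rewrite exprMn !enorm_sq /dot2 /det2; ring. Qed.

Lemma sin_atan (x : R) : sin (atan x) = x * cos (atan x).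
Proof.
have c0 : cos (atan x) != 0 by rewrite gt_eqF // cos_gt0_pihalf // atan_gtNpi2 atan_ltpi2.
by have := atanK x; rewrite /tan => /(canRL (divfK c0)).
Qed.

Lemma cos_atan_sq (x : R) : cos (atan x) ^+ 2 = (1 + x ^+ 2)^-1.
Proof. by rewrite cos_atan exprVn sqr_sqrtr // addr_ge0 // sqr_ge0. Qed.

(** By [lagrange2] the half-angle formulas give the angle the cosine [dot2 u v / N] and the sine
    [det2 u v / N], with [N] the product of the norms. The addition formulas then recover [v]. *)
Lemma normalize_angle u v t :
  normalize u = unit_circle t -> 0 < enorm u * enorm v + dot2 u v ->
  normalize v = unit_circle (t + angle u v).
Proof.
move=> /normalizeP[u0 uc us] D0.
have v0 : 0 < enorm v.
  rewrite lt_neqAle enorm_ge0 andbT eq_sym; apply: contraTneq D0 => v0.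
  have [z0 z1] := enorm_eq0 v0; rewrite v0.
  by rewrite /dot2 z0 z1 !mulr0 !addr0 ltxx.
have N0 : 0 < enorm u * enorm v by rewrite mulr_gt0.
have := lagrange2 u v.
rewrite /angle; set N := _ * _ in D0 N0 *; set A := dot2 u v in D0 *.
set B := det2 u v; set x := B / (N + A) => L.
have Dn : N + A != 0 by rewrite gt_eqF.
have x1 : 1 + x ^+ 2 = 2 * N / (N + A).
  rewrite /x expr_div_n.
  apply: (mulIf (expf_neq0 2 Dn)); rewrite mulrDl divfK ?expf_neq0 //.
  rewrite mul1r [in RHS]expr2 mulrA divfK //.
  have -> : B ^+ 2 = N ^+ 2 - A ^+ 2 by rewrite L addrAC subrr add0r.
  by ring.
have c2 : cos (atan x) ^+ 2 = (N + A) / (2 * N) by rewrite cos_atan_sq x1 invf_div.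
have Nn : N != 0 by rewrite gt_eqF.
have ca : cos (2 * atan x) = A / N.
  by rewrite mulr_natl cos_mulr2n c2; field; rewrite Nn.
have sa : sin (2 * atan x) = B / N.
  rewrite mulr_natl sin_mulr2n sin_atan mulrCA -expr2 c2 /x.
  by field; rewrite Nn Dn.
have un : enorm u != 0 by rewrite gt_eqF.
have vn : enorm v != 0 by rewrite gt_eqF.
have cE : cos t = u 0 0 / enorm u by rewrite uc mulrC mulKf.
have sE : sin t = u 0 1 / enorm u by rewrite us mulrC mulKf.
apply/normalizeP; split => //.
  rewrite cosD ca sa cE sE /N /A /B /dot2 /det2.
  apply: (mulfI (expf_neq0 2 un)); rewrite {1}enorm_sq.
  by field; rewrite un vn.
rewrite sinD ca sa cE sE /N /A /B /dot2 /det2.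
apply: (mulfI (expf_neq0 2 un)); rewrite {1}enorm_sq.
by field; rewrite un vn.
Qed.

(** For [s = 0] the value is twice the squared norm of [u]. Otherwise the moving point is not
    parallel to [u], so Cauchy-Schwarz is strict. *)
Lemma angle_denom_gt0 u v s : det2 u v != 0 -> 0 <= s <= 1 ->
  0 < enorm u * enorm (u + s *: (v - u)) + dot2 u (u + s *: (v - u)).
Proof.
move=> d0 /andP[s0 _].
have dE : det2 u (u + s *: (v - u)) = s * det2 u v by rewrite /det2 !mxE; ring.
have [s_eq0|s_neq0] := eqVneq s 0.
  rewrite s_eq0 scale0r addr0.
  have -> : enorm u * enorm u + dot2 u u = 2 * enorm u ^+ 2.
    by rewrite enorm_sq -expr2 enorm_sq /dot2; ring.
  by rewrite mulr_gt0 // exprn_gt0 // (enorm_gt0_det2 d0).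
set w := u + _ in dE *.
have w0 : det2 u w != 0 by rewrite dE mulf_neq0.
have : 0 < det2 u w ^+ 2 by rewrite exprn_even_gt0.
have := lagrange2 u w; have := mulr_ge0 (enorm_ge0 u) (enorm_ge0 w).
by set N := _ * _; nra.
Qed.

(** Reparametrizing by a map [c] into [0, 1] keeps the denominator positive on the whole line, so
    continuity is global. *)
Lemma continuous_angle_segment (c : R -> R) u v :
  continuous c -> (forall t, 0 <= c t <= 1) -> det2 u v != 0 ->
  continuous (fun t => angle u (u + c t *: (v - u))).
Proof.
move=> c_cont c01 d0 t.
pose w x := u + c x *: (v - u).
have w_cvg j : w x 0 j @[x --> t] --> w t 0 j.
  have E x : w x 0 j = u 0 j + c x * (v 0 j - u 0 j) by rewrite !mxE.
  rewrite E; under eq_fun => x do rewrite E.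
  apply: cvgD; first exact: cvg_cst.
  by apply: cvgM; [exact: c_cont|exact: cvg_cst].
apply: cvgM; first exact: cvg_cst.
apply: continuous_cvg; first exact: continuous_atan.
apply: cvgM.
  by apply: cvgB; (apply: cvgM; [exact: cvg_cst|exact: w_cvg]).
apply: cvgV; first by rewrite gt_eqF // angle_denom_gt0.
apply: cvgD.
  apply: cvgM; first exact: cvg_cst.
  apply: (@continuous_cvg _ _ _ _ _ (fun x => w x 0 0 ^+ 2 + w x 0 1 ^+ 2) (@Num.sqrt R)).
    exact: sqrt_continuous.
  by apply: cvgD; apply: cvgM; exact: w_cvg.
by apply: cvgD; (apply: cvgM; [exact: cvg_cst|exact: w_cvg]).
Qed.

End PolarCoordinates.

(** * Continuous lifts of closed polygons and the angle swept on a segment *)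

Section PolygonLift.
Local Open Scope classical_set_scope.
Variable R : realType.

(** The projection of the line onto [0, 1], written with absolute values to make its continuity
    immediate. *)
Definition clamp (t : R) : R := (`|t| - `|t - 1| + 1) / 2.

Lemma clamp_le0 t : t <= 0 -> clamp t = 0.
Proof. by move=> t0; rewrite /clamp ler0_norm // ler0_norm; lra. Qed.

Lemma clamp_ge1 t : 1 <= t -> clamp t = 1.
Proof. by move=> t1; rewrite /clamp ger0_norm ?ger0_norm; lra. Qed.

Lemma clamp_id t : 0 <= t <= 1 -> clamp t = t.
Proof. by move=> /andP[t0 t1]; rewrite /clamp ger0_norm // ler0_norm; lra. Qed.

Lemma clamp01 t : 0 <= clamp t <= 1.
Proof.
have [/clamp_le0->|t0] := lerP t 0; first by rewrite lexx ler01.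
have [/clamp_ge1->|t1] := lerP 1 t; first by rewrite lexx ler01.
by rewrite clamp_id !ltW.
Qed.

Lemma continuous_clamp : continuous clamp.
Proof.
move=> t; apply: cvgM; last exact: cvg_cst.
apply: cvgD; last exact: cvg_cst.
apply: cvgB; first exact: norm_continuous.
apply: cvg_norm.
by apply: cvgB; [exact: cvg_id|exact: cvg_cst].
Qed.

(** On the [j]-th unit interval the earlier terms have reached their final value and the later ones
    are still zero. One sum thus concatenates paths without case distinction. *)
Lemma sum_clamp (V : zmodType) (F : nat -> R -> V) n j s :
  (forall i, F i 0 = 0) -> (j < n)%N -> 0 <= s <= 1 ->
  \sum_(0 <= i < n) F i (clamp (j%:R + s - i%:R)) =
  \sum_(0 <= i < j) F i 1 + F j s.
Proof.
move=> F0 jn s01; have /andP[s0 s1] := s01.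
rewrite (big_cat_nat (n := j)) ?leq0n ?(ltnW jn) //=; congr (_ + _).
  rewrite !big_nat; apply: eq_bigr => i /andP[_ ij]; rewrite clamp_ge1 //.
  have : i.+1%:R <= j%:R :> R by rewrite ler_nat.
  by rewrite -natr1; lra.
rewrite big_ltn // [j%:R + s]addrC addrK clamp_id //.
rewrite big_nat big1 ?addr0 // => i /andP[ji _].
rewrite clamp_le0 ?F0 //.
have : j.+1%:R <= i%:R :> R by rewrite ler_nat.
by rewrite -natr1; lra.
Qed.

(** Allowing [s = 1] puts the right endpoint in the last segment. *)
Lemma floor_part (n : nat) (t : R) : 0 <= t <= n.+1%:R ->
  exists j s, [/\ (j < n.+1)%N, 0 <= s <= 1 & t = j%:R + s].
Proof.
elim: n => [|n IH] /andP[t0 tn].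
  by exists 0%N, t; split; rewrite ?add0r // t0.
have [tn'|tn'] := lerP t n.+1%:R.
  by case: IH => [|j [s [jn s01 E]]]; [rewrite t0|exists j, s; rewrite ltnS ltnW].
exists n.+1, (t - n.+1%:R); split; first exact: ltnSn.
  by move: tn; rewrite -(natr1 n.+1); lra.
by rewrite addrC subrK.
Qed.

Lemma polygon_lift n (p : nat -> 'rV[R]_2) :
  (forall i, (i < n.+1)%N -> det2 (p i) (p i.+1) != 0) ->
  exists (gamma : R -> 'rV[R]_2) (theta : R -> R),
    [/\ forall i s, (i < n.+1)%N -> 0 <= s <= 1 ->
          gamma (i%:R + s) = (1 - s) *: p i + s *: p i.+1,
        continuous theta
      & forall t, 0 <= t <= n.+1%:R ->
          normalize (gamma t) = unit_circle (theta t)].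
Proof.
move=> d0.
pose e : 'rV[R]_2 := unit_circle 0.
have e0 : normalize e = unit_circle 0.
  apply/normalizeP; rewrite /enorm !mxE /= cos0 sin0 expr1n expr0n addr0 sqrtr1.
  by rewrite ltr01 mulr1 mulr0.
(* The angle of the first vertex is measured from (1, 0). The half-angle formula fails only on the
   negative axis, where the angle is [pi]. *)
have [t0 t0P] : exists t0, normalize (p 0%N) = unit_circle t0.
  case: (ltrP 0 (enorm e * enorm (p 0%N) + dot2 e (p 0%N))) => [/(normalize_angle e0)|].
    by exists (0 + angle e (p 0%N)).
  have -> : dot2 e (p 0%N) = p 0%N 0 0 by rewrite /dot2 !mxE /= cos0 sin0; ring.
  have -> : enorm e = 1.
    by rewrite /enorm !mxE /= cos0 sin0 expr1n expr0n addr0 sqrtr1.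
  rewrite mul1r => le0; exists pi.
  have pn : 0 < enorm (p 0%N).
    exact: enorm_gt0_det2 (d0 0%N isT).
  have sq := enorm_sq (p 0%N).
  have y0 : p 0%N 0 1 = 0 by apply/eqP; rewrite -sqrf_eq0; apply/eqP; nra.
  apply/normalizeP; rewrite cospi sinpi mulr0 mulrN1.
  by split => //; rewrite y0 in sq; nra.
pose F i c := angle (p i) (p i + c *: (p i.+1 - p i)).
pose G i c := c *: (p i.+1 - p i).
have F0 i : F i 0 = 0 by rewrite /F scale0r addr0 anglexx.
have G0 i : G i 0 = 0 by rewrite /G scale0r.
pose theta t := t0 + \sum_(0 <= i < n.+1) F i (clamp (t - i%:R)).
pose gamma t := p 0%N + \sum_(0 <= i < n.+1) G i (clamp (t - i%:R)).
have Gj j : p 0%N + \sum_(0 <= i < j) G i 1 = p j.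
  by under eq_bigr => i _ do rewrite /G scale1r; rewrite telescope_sumr // addrC subrK.
have gammaE i s : (i < n.+1)%N -> 0 <= s <= 1 -> gamma (i%:R + s) = p i + G i s.
  by move=> i_n s01; rewrite /gamma sum_clamp // addrA Gj.
have thetaj j : (j <= n)%N ->
    normalize (p j) = unit_circle (t0 + \sum_(0 <= i < j) F i 1).
  elim: j => [|j IH] jn; first by rewrite big_nil addr0.
  rewrite big_nat_recr //= addrA /F scale1r [p j + _]addrC subrK.
  apply: normalize_angle; first exact: IH (ltnW jn).
  have := @angle_denom_gt0 _ (p j) (p j.+1) 1 (d0 _ (ltnW jn)).
  by rewrite scale1r [p j + _]addrC subrK; apply; rewrite ler01 lexx.
exists gamma, theta; split.
- move=> i s i_n s01; rewrite gammaE // /G scalerBr scalerBl scale1r.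
  by rewrite -!addrA [- _ + _]addrC.
- move=> t; apply: cvgD; first exact: cvg_cst.
  rewrite big_nat; under eq_fun => x do rewrite big_nat.
  apply: cvg_big => [|i /andP[_ i_n]]; first exact: add_continuous.
  apply: (@continuous_angle_segment _ (fun t => clamp (t - i%:R))) => [x|x|].
  + apply: (@continuous_comp _ _ _ (fun t : R => t - i%:R) clamp);
      last exact: continuous_clamp.
    by apply: cvgB; [exact: cvg_id|exact: cvg_cst].
  + exact: clamp01.
  + exact: d0.
- move=> t /floor_part[j [s [jn s01 ->]]].
  rewrite gammaE // /theta sum_clamp // addrA; apply: normalize_angle.
    exact: thetaj.
  exact: angle_denom_gt0 (d0 _ jn) s01.
Qed.

(** By the intermediate value theorem a sweep of absolute value at least [pi] would pass through
    [pi] or [- pi], where the sine vanishes. The sign at [s = 1] then excludes a nonpositive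
    sweep. *)
Lemma angle_sweep (h : R -> R) (a : R) :
  {within `[a, a + 1], continuous h} ->
  (forall s, 0 < s <= 1 -> 0 < sin (h (a + s) - h a)) ->
  0 < h (a + 1) - h a < pi.
Proof.
move=> h_cont sin0; have pi0 := pi_gt0 R.
have a1 : a <= a + 1 by rewrite lerDl.
have no_hit v : v = pi \/ v = - pi ->
    ~ (Num.min (h a) (h (a + 1)) <= h a + v <= Num.max (h a) (h (a + 1))).
  move=> vE /(IVT a1 h_cont)[c]; rewrite in_itv /= => /andP[ac ca] hc.
  have [cE|ca'] := eqVneq c a.
    by move: hc; rewrite cE; case: vE => ->; lra.
  have s01 : 0 < c - a <= 1 by rewrite subr_gt0 lt_neqAle eq_sym ca' ac lerBlDl ca.
  have := sin0 _ s01; rewrite [a + _]addrC subrK hc [h a + v]addrC addrK.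
  by case: vE => ->; rewrite ?sinN sinpi ?oppr0 ltxx.
have s1 := sin0 1 (introT andP (conj (@ltr01 R) (lexx 1))).
have hi : h (a + 1) - h a < pi.
  rewrite ltNge; apply/negP => le; apply: (no_hit pi (or_introl erefl)).
  rewrite ge_min le_max; apply/andP; split; apply/orP; [left|right]; lra.
have lo : - pi < h (a + 1) - h a.
  rewrite ltNge; apply/negP => le; apply: (no_hit (- pi) (or_intror erefl)).
  rewrite ge_min le_max; apply/andP; split; apply/orP; [right|left]; lra.
rewrite hi andbT ltNge; apply/negP => le.
by have := sin_le0_Npi (introT andP (conj (ltW lo) le)); rewrite leNgt s1.
Qed.

(** The determinant of [u] with the moving point is [s * det2 u v], of constant sign. The sign [e]
    covers the closing segment, whose direction depends on the parity of [k]. *)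
Lemma segment_sweep (a : R) (gamma : R -> 'rV[R]_2) (theta : R -> R)
    (u v : 'rV[R]_2) (e : bool) :
  {within `[a, a + 1], continuous theta} ->
  (forall s, 0 <= s <= 1 -> gamma (a + s) = (1 - s) *: u + s *: v) ->
  (forall s, 0 <= s <= 1 -> normalize (gamma (a + s)) = unit_circle (theta (a + s))) ->
  0 < (-1) ^+ e * det2 u v ->
  0 < (-1) ^+ e * (theta (a + 1) - theta a) < pi.
Proof.
move=> th_cont gE nE d0; rewrite mulrBr.
apply: (@angle_sweep (fun x => (-1) ^+ e * theta x)).
  by move=> x; apply: cvgM; [exact: cvg_cst|exact: th_cont].
move=> s /andP[s0 s1]; rewrite -mulrBr.
have [z0 z1] : ((0 : R) <= 0) /\ ((0 : R) <= 1) by [].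
have z01 := introT andP (conj z0 z1).
have s01 : 0 <= s <= 1 by rewrite ltW.
have := det2_polar (nE 0 z01) (nE s s01); have /normalizeP[ps _ _] := nE s s01.
have /normalizeP[p0 _ _] := nE 0 z01.
rewrite !gE // subr0 scale1r scale0r addr0 in ps p0 *.
have -> : det2 u ((1 - s) *: u + s *: v) = s * det2 u v by rewrite /det2 !mxE; ring.
rewrite addr0 => dE.
have -> : sin ((-1) ^+ e * (theta (a + s) - theta a)) =
    (-1) ^+ e * sin (theta (a + s) - theta a).
  by case: (e); rewrite ?expr0 ?mul1r // expr1 !mulN1r sinN.
have : 0 < (-1) ^+ e * (s * det2 u v) by rewrite mulrCA mulr_gt0.
by rewrite dE mulrCA pmulr_rgt0 // mulr_gt0.
Qed.

End PolygonLift.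

(** * Subspaces and the matrices representing them *)

Section RowSpaces.
Variables (R : realType) (k m : nat).
Implicit Types (C : 'M[R]_(k, m)) (V : {vspace 'rV[R]_m}).

Lemma nth_rows C (i : 'I_k) : [seq row j C | j : 'I_k]`_i = row i C.
Proof.
have sz : (i < size (enum 'I_k))%N by rewrite size_enum_ord.
by rewrite (nth_map i) // nth_ord_enum.
Qed.

Lemma memv_represents C V v : represents C V -> (v \in V) = (v <= C)%MS.
Proof.
have sz : size [seq row j C | j : 'I_k] == k by rewrite size_map size_enum_ord.
move=> ->; apply/idP/idP => [vX|/submxP[D ->]].
  have := coord_span (X := Tuple sz) vX => /= ->.
  apply: summx_sub => i _; apply: scalemx_sub.
  by rewrite nth_rows row_sub.
rewrite mulmx_sum_row; apply: memv_suml => i _; apply/memvZ/memv_span.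
by apply: map_f; rewrite mem_enum.
Qed.

Lemma represents_eqmx C C' V :
  represents C V -> represents C' V <-> (C == C')%MS.
Proof.
move=> rC; split=> [rC'|/andP[CC' C'C]].
  apply/andP; split; apply/row_subP => i.
    by rewrite -(memv_represents _ rC') (memv_represents _ rC) row_sub.
  by rewrite -(memv_represents _ rC) (memv_represents _ rC') row_sub.
have r' : represents C' <<[seq row i C' | i : 'I_k]>>%VS by [].
rewrite rC; apply/vspaceP => v; rewrite -[in LHS]rC.
rewrite (memv_represents _ rC) (memv_represents _ r').
by apply/idP/idP => /submx_trans; apply.
Qed.

Lemma Gr_row_free C V : represents C V -> Gr k V <-> row_free C.
Proof.
have sz : size [seq row j C | j : 'I_k] == k by rewrite size_map size_enum_ord.
move=> ->.
have -> : Gr k <<[seq row i C | i : 'I_k]>>%VS <-> free (Tuple sz).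
  by rewrite /Gr /= /free [X in _ == X](eqP sz); split => /eqP.
have comb (c : 'I_k -> R) : \sum_(i < k) c i *: (Tuple sz)`_i = (\row_i c i) *m C.
  by rewrite mulmx_sum_row; apply: eq_bigr => i _; rewrite nth_rows mxE.
split=> [/freeP fr|rf].
  rewrite -kermx_eq0; apply/rowV0P => v /sub_kermxP vC.
  apply/rowP => i; rewrite mxE; apply: (fr (fun i => v 0 i)).
  by rewrite comb -[RHS]vC; congr (_ *m _); apply/rowP => j; rewrite mxE.
apply/freeP => c; rewrite comb => c0 i.
have : \row_i c i = 0 by apply: (row_free_inj rf); rewrite c0 mul0mx.
by move/rowP/(_ i); rewrite !mxE.
Qed.

End RowSpaces.

(** * Coordinates on the oriented quotient plane *)

Section OrientedQuotient.
Variables (R : realType) (k : nat).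
Implicit Types (C : 'M[R]_(k, k + 2)) (P : 'M[R]_(k + 2, 2)) (u v : 'rV[R]_(k + 2)).

Lemma bracket_neq0_row_free C u v : bracket C u v != 0 -> row_free C.
Proof.
rewrite -unitfE -unitmxE -row_free_unit => rf.
rewrite -kermx_eq0; apply/rowV0P => w /sub_kermxP wC.
have : row_mx w (0 : 'rV[R]_(1 + 1)) = 0.
  apply: (row_free_inj rf); rewrite mul0mx.
  by apply: etrans (mul_row_col _ _ _ _) _; rewrite wC mul0mx addr0.
by move/(congr1 lsubmx); rewrite row_mxKl linear0.
Qed.

Lemma bracket_neq0_eqmx C C' u v :
  (C == C')%MS -> bracket C u v != 0 -> bracket C' u v != 0.
Proof.
move=> /andP[/submxP[g ->] _]; rewrite /bracket det_col_mx_mul.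
by apply: contraNneq => ->; rewrite mulr0.
Qed.

Lemma bracketC C u v : bracket C v u = - bracket C u v.
Proof.
pose s : 'S_2 := tperm 0 1.
have E : col_mx C (col_mx v u) =
    block_mx 1%:M 0 0 (perm_mx s) *m col_mx C (col_mx u v : 'M[R]_(2, k + 2)).
  rewrite mul_block_col mul1mx !mul0mx addr0 add0r; congr col_mx.
  rewrite -row_permE; apply/matrixP => i j; rewrite [RHS]mxE.
  have [-> | ->] := ord2P i; rewrite ?tpermL ?tpermR !mxE.
    by case: splitP => a //; case: splitP => b //; rewrite !ord1.
  by case: splitP => a //; case: splitP => b //; rewrite !ord1.
rewrite /bracket E det_mulmx det_ublock det1 mul1r det_perm odd_tperm /=.
by rewrite expr1 mulN1r.
Qed.

Lemma det2C (u v : 'rV[R]_2) : det2 v u = - det2 u v.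
Proof. by rewrite /det2; ring. Qed.

(** The orientation clause speaks of positive signs only; exchanging the two vectors gives the
    negative ones. *)
Lemma oriented_quotient_gt0 C P u v (e : bool) : oriented_quotient C P ->
  (0 < (-1) ^+ e * bracket C u v) = (0 < (-1) ^+ e * det2 (u *m P) (v *m P)).
Proof.
case=> _ _ sgn; case: e; rewrite ?expr0 ?expr1 ?mul1r ?mulN1r.
  by rewrite -bracketC -det2C -det_col_mx2; apply/idP/idP => /sgn.
by rewrite -det_col_mx2; apply/idP/idP => /sgn.
Qed.

Lemma oriented_quotient_mul0 C P : oriented_quotient C P -> C *m P = 0.
Proof.
case=> _ ker _; apply/row_matrixP => i; rewrite row_mul row0.
by apply/ker; rewrite row_sub.
Qed.

(** Complete [C] by [u] and [v] to an invertible matrix [M]. The last two columns of its inverse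
    kill [C] and send [u], [v] to the standard basis; the bracket is the plane determinant times
    [\det M > 0]. *)
Lemma oriented_quotient_exists C u v :
  0 < bracket C u v -> exists P, oriented_quotient C P.
Proof.
move=> b0; set D : 'M[R]_(2, k + 2) := col_mx u v.
pose M : 'M[R]_(k + 2) := col_mx C D; pose N := invmx M.
have Mu : M \in unitmx by rewrite unitmxE unitfE gt_eqF.
have MN : M *m N = 1%:M by rewrite mulmxV.
pose P := rsubmx N; pose Q := lsubmx N.
have NE : N = row_mx Q P by rewrite hsubmxK.
move: MN; rewrite NE mul_col_row (scalar_mx_block k 2) => /eq_block_mx[CQ CP DQ DP].
exists P; split.
- by apply/row_fullP; exists D.
- move=> w; split => [wP|/submxP[A ->]]; last by rewrite -mulmxA CP mulmx0.
  have -> : w = (w *m Q) *m C.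
    rewrite -[LHS]mulmx1 -(mulVmx Mu) -/N NE mulmxA mul_mx_row wP.
    by rewrite mul_row_col mul0mx addr0.
  exact: submxMl.
- move=> f1 f2; set F : 'M[R]_(2, k + 2) := col_mx f1 f2.
  have -> : bracket C f1 f2 = \det (F *m P) * \det M.
    rewrite -[LHS](mulr1 _) -(det1 _ (k + 2)) -(mulVmx Mu) det_mulmx mulrA -det_mulmx.
    by rewrite -/N NE mul_col_row CQ CP det_lblock det1 mul1r.
  by rewrite pmulr_lgt0 // (mul_col_mx f1 f2 P : F *m P = _).
Qed.

End OrientedQuotient.

(** * Angles swept by the closed polygon at its vertices *)

Section PolygonAngles.
Local Open Scope classical_set_scope.
Local Open Scope ring_scope.
Variables (R : realType) (n : nat) (z : 'M[R]_(n.+2, 2)).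

(** Indexing by naturals modulo the number of vertices makes the closing segment the one from index
    [n.+1] to [n.+2]. *)
Definition cyclic_row (i : nat) : 'rV[R]_2 := row (inord (i %% n.+2)) z.

Lemma cyclic_row_ord (i : 'I_n.+2) : cyclic_row i = row i z.
Proof. by rewrite /cyclic_row modn_small // inord_val. Qed.

Lemma cyclic_rowS (i : 'I_n.+2) : cyclic_row i.+1 = row (ordS i) z.
Proof.
by rewrite /cyclic_row; congr (row _ z); apply/val_inj; rewrite /= inordK ?ltn_mod.
Qed.

(** Vertices are reached at integer times, so [phi] is the lift at integers, shifted to start at 0,
    and [r] collects Euclidean norms. For a closed path the two end directions agree, so the total
    angle has sine 0. *)
Lemma polygon_angles (e : bool) (gamma : R -> 'rV[R]_2) (theta : R -> R) :
  (forall i j : 'I_n.+2, j = i.+1 :> nat -> 0 < det2 (row i z) (row j z)) ->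
  0 < (-1) ^+ e * det2 (row ord_max z) (row ord0 z) ->
  closed_polygon (fun i => row i z) gamma ->
  {within `[0, n.+2%:R], continuous theta} ->
  (forall t, t \in `[0, n.+2%:R] -> normalize (gamma t) = unit_circle (theta t)) ->
  exists (phi : nat -> R) (r : 'I_n.+2 -> R),
  [/\ phi 0%N = 0 /\ (forall i, (i < n.+1)%N -> 0 < phi i.+1 - phi i < pi),
      forall i, 0 < r i,
      forall i : 'I_n.+2, det2 (row ord0 z) (row i z) = r i * sin (phi i),
      0 < (-1) ^+ e * (theta n.+2%:R - theta 0 - phi n.+1) < pi
    & gamma 0 = gamma n.+2%:R -> sin (theta n.+2%:R - theta 0) = 0].
Proof.
move=> d0 dlast gE th_cont nE.
have in_dom (t : R) : 0 <= t -> t <= n.+2%:R ->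
    normalize (gamma t) = unit_circle (theta t).
  by move=> a b; apply: nE; rewrite in_itv /= a b.
have gi (i : 'I_n.+2) : gamma i%:R = row i z.
  have := gE i 0; rewrite lexx ler01 addr0 => ->//.
  by rewrite subr0 scale1r scale0r addr0.
have ni (i : 'I_n.+2) : normalize (row i z) = unit_circle (theta i%:R).
  by rewrite -gi in_dom // ler_nat ltnW.
have sweep (i : 'I_n.+2) (b : bool) : 0 < (-1) ^+ b * det2 (row i z) (row (ordS i) z) ->
    0 < (-1) ^+ b * (theta i.+1%:R - theta i%:R) < pi.
  have iS : i%:R + 1 <= n.+2%:R :> R by rewrite natr1 ler_nat.
  rewrite -natr1; apply: (@segment_sweep _ _ gamma).
  - apply: continuous_subspaceW th_cont.
    by apply: subset_itv; rewrite bnd_simp.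
  - by move=> s s01; rewrite gE.
  - move=> s /andP[s0 s1]; apply: in_dom; first by rewrite addr_ge0.
    by apply: le_trans iS; rewrite lerD2l.
exists (fun i => theta i%:R - theta 0), (fun i => enorm (row ord0 z) * enorm (row i z)).
split.
- split=> [|i i_n]; first by rewrite subrr.
  have -> : theta i.+1%:R - theta 0 - (theta i%:R - theta 0) =
    theta i.+1%:R - theta i%:R by ring.
  have := @sweep (Ordinal (leqW i_n : i < n.+2)%N) false; rewrite expr0 !mul1r; apply.
  by apply: d0 => /=; rewrite modn_small.
- move=> i; have /normalizeP[? _ _] := ni i.
  by have /normalizeP[? _ _] := ni ord0; apply: mulr_gt0.
- by move=> i; apply: det2_polar; rewrite ni.
- have -> : theta n.+2%:R - theta 0 - (theta n.+1%:R - theta 0) =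
    theta n.+2%:R - theta n.+1%:R by ring.
  apply: (@sweep ord_max).
  by have -> : ordS (@ord_max n.+1) = ord0 by apply/val_inj; rewrite /= modnn.
- move=> gn; have n0 : (0 : R) <= n.+2%:R by [].
  have := det2_polar (in_dom _ (lexx _) n0) (in_dom _ n0 (lexx _)).
  have /normalizeP[p0 _ _] := in_dom _ (lexx _) n0.
  rewrite -gn det2xx => /esym/eqP; rewrite mulf_eq0 => /orP[|/eqP//].
by rewrite mulf_eq0 gt_eqF.
Qed.

End PolygonAngles.

(** * Winding number and swept range *)

Section Winding.
Variable R : realType.

Lemma winding_double k : (2 * ((k + 1) %/ 2) = k + odd k)%N.
Proof. lia. Qed.

(* [T] is the total angle of the closed polygon, [phi] the part swept before the
   closing segment, whose sign is given by the parity of [k]. *)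
Lemma swept_range_of_winding k (phi T : R) :
  0 < (-1) ^+ k.+1 * (T - phi) < pi ->
  T = 2 * pi * (Posz ((k + 1) %/ 2))%:~R -> k%:R * pi < phi < k%:R * pi + pi.
Proof.
have -> : 2 * pi * (Posz ((k + 1) %/ 2))%:~R = k%:R * pi + (odd k)%:R * pi :> R.
  by rewrite -pmulrn -mulrDl -natrD -winding_double natrM; ring.
move=> + TE; rewrite {}TE -signr_odd /=; case: (odd k) => /=; rewrite ?expr0 ?expr1; lra.
Qed.

(** The bounds place [T] at distance less than [pi] from [(k + odd k) pi], and [sin T = 0] makes it
    a multiple of [pi]. *)
Lemma winding_of_swept_range k (phi T : R) :
  0 < (-1) ^+ k.+1 * (T - phi) < pi -> sin T = 0 ->
  k%:R * pi < phi < k%:R * pi + pi -> T = 2 * pi * (Posz ((k + 1) %/ 2))%:~R.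
Proof.
have -> : 2 * pi * (Posz ((k + 1) %/ 2))%:~R = (k + odd k)%:R * pi :> R.
  by rewrite -pmulrn -winding_double natrM; ring.
move=> clo sT rng; pose x := T - (k + odd k)%:R * pi.
have sx : sin x = 0 by rewrite sin_subn_pi sT mulr0.
have [x_gt x_lt] : - pi < x /\ x < pi.
  rewrite /x natrD mulrDl; move: clo rng; rewrite -signr_odd /=.
  by case: (odd k) => /=; rewrite ?expr0 ?expr1; lra.
apply/eqP; rewrite -subr_eq0 -/x.
case: (ltrgtP x 0) => // [x0|x0].
  by have := sin_lt0_Npi (introT andP (conj x_gt x0)); rewrite sx ltxx.
by have := sin_gt0_pi (introT andP (conj x0 x_lt)); rewrite sx ltxx.
Qed.

End Winding.

(** * The two implications *)

Section Main.
Local Open Scope classical_set_scope.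
Local Open Scope ring_scope.
Variables (R : realType) (n k : nat) (Z : 'M[R]_(n.+2, k + 2)).
Hypothesis Zgt0 : Mat_gt0 Z.

Let w_form (z : 'M[R]_(n.+2, 2)) : 'cV[R]_n.+2 :=
  \col_i det2 (row ord0 z) (row i z).

Let w_form_mul (z : 'M[R]_(n.+2, 2)) m (C : 'M[R]_(m, n.+2)) :
  C *m z = 0 -> C *m w_form z = 0.
Proof.
move=> Cz.
(* The determinant with [z_0] is a linear functional on the plane, hence a product with a column. *)
have -> : w_form z = z *m (\col_j (if j == 0 then - z ord0 1 else z ord0 0)).
  apply/colP => i; rewrite !mxE !big_ord_recl big_ord0 !mxE /det2 /=.
  have -> : lift ord0 ord0 = 1 :> 'I_2 by apply/val_inj.
  have -> : @ord0 1 = 0 by apply/val_inj.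
  by rewrite /det2 !mxE; ring.
by rewrite mulmxA Cz mul0mx.
Qed.

(** Positivity of [Z] excludes angles from [(k + 2) pi] on, the kernel argument those below
    [(k - 1) pi]. The sine at the last vertex removes the two outer intervals that remain. *)
Lemma swept_angle_range (C1 : 'M[R]_(k, n.+2)) (P : 'M[R]_(k + 2, 2))
    (phi : nat -> R) (r : 'I_n.+2 -> R) (f : 'I_k -> 'I_n.+2) :
  (forall g : 'I_k -> 'I_n.+2, increasing g -> 0 <= \det (colsub g C1)) ->
  increasing f -> 0 < \det (colsub f C1) ->
  row_full P -> C1 *m (Z *m P) = 0 ->
  phi 0%N = 0 -> (forall i, (i < n.+1)%N -> 0 < phi i.+1 - phi i < pi) ->
  (forall i, 0 < r i) ->
  (forall i : 'I_n.+2,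
     det2 (row ord0 (Z *m P)) (row i (Z *m P)) = r i * sin (phi i)) ->
  (forall i j : 'I_n.+2, j = i.+1 :> nat ->
     0 < det2 (row i (Z *m P)) (row j (Z *m P))) ->
  0 < (-1) ^+ k.+1 * det2 (row ord_max (Z *m P)) (row ord0 (Z *m P)) ->
  k%:R * pi < phi n.+1 < k%:R * pi + pi.
Proof.
move=> C1_ge0 f_incr C1f Pfull CzP phi0 steps r0 wE d0 dlast.
have pi0 := pi_gt0 R.
have phi_lt := steps_increasing steps.
have phi_ge0 i : (i <= n.+1)%N -> 0 <= phi i.
  by case: i => [|i] i_n; rewrite -?phi0 // ltW // phi_lt.
have phi_le i : (i <= n.+1)%N -> phi i <= phi n.+1.
  by rewrite leq_eqVlt => /predU1P[->//|/phi_lt h]; apply/ltW/h.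
have hi : phi n.+1 < k%:R * pi + pi *+ 2.
  rewrite ltNge; apply/negP => le.
  have phiK : (k + 2)%:R * pi <= phi n.+1.
    by rewrite natrD mulrDl [2 * pi]mulr_natl.
  have [C [g [C_ge0 Cz g_incr _ Cg]]] := crossing_matrix phi0 steps r0 wE d0 phiK.
  have Z_ge0 h hi := ltW (Zgt0 (f := h) hi).
  have : 0 < \det (C *m Z).
    exact: (row_form_mulmx_gt0 (@det_row_multilinear _ _) (@det_row_alternating _ _)
      C_ge0 Z_ge0 Cg (Zgt0 g_incr)).
  move=> dCZ; have u : C *m Z \in unitmx by rewrite unitmxE unitfE gt_eqF.
  (* [C *m Z] is square and invertible but kills [P], which has rank 2. *)
  have P0 : P = 0 by rewrite -[P](mulKmx u) -mulmxA Cz mulmx0.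
  by move: Pfull; rewrite P0 /row_full mxrank0.
have lo : k%:R * pi - pi <= phi n.+1.
  have [k0|k_gt0] := posnP k.
    by rewrite k0 mul0r sub0r; have := phi_ge0 n.+1 (leqnn _); lra.
  rewrite -(prednK k_gt0) -natr1 mulrDl mul1r addrK leNgt; apply/negP => lt.
  apply: (nonneg_kernel_angle k_gt0 C1_ge0 f_incr C1f (w_form_mul CzP)
    (phi := fun i => phi i) _ r0).
  - by move=> i j ij; apply: phi_lt => //; rewrite -ltnS.
  - by move=> i; rewrite mxE wE.
  - move=> i; have i_n : (i <= n.+1)%N by rewrite -ltnS.
    by rewrite phi_ge0 //= (le_lt_trans (phi_le _ i_n)).
have sx : 0 < sin (phi n.+1 - k%:R * pi).
  move: dlast; rewrite det2C wE exprS mulN1r mulrNN mulrCA pmulr_rgt0 //=.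
  by rewrite sin_subn_pi.
apply/andP; split; rewrite ltNge; apply/negP => le.
  suff : sin (phi n.+1 - k%:R * pi) <= 0 by rewrite leNgt sx.
  by apply: sin_le0_Npi; apply/andP; split; lra.
suff : sin (phi n.+1 - k%:R * pi) <= 0 by rewrite leNgt sx.
by apply: sin_le0_2pi; apply/andP; split; move: hi; rewrite mulr2n; lra.
Qed.

Variables (Y : {vspace 'rV[R]_(k + 2)}).
Hypothesis Ywcb : Gr_wcb Z Y.

Lemma wcb_bracket (C : 'M[R]_(k, k + 2)) : represents C Y ->
  (forall i j : 'I_n.+2, j = i.+1 :> nat -> bracket C (row i Z) (row j Z) != 0) /\
  bracket C (row ord_max Z) (row ord0 Z) != 0.
Proof.
case: Ywcb => _ [C0 rC0 tw] rC.
have CC : (C0 == C)%MS by apply/(represents_eqmx _ rC0).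
split=> [i j ji|]; apply: (bracket_neq0_eqmx CC).
  suff -> : j = ordS i by apply: tw.
  by apply/val_inj; rewrite /= -ji modn_small.
have := tw ord_max; have -> // : ordS (@ord_max n.+1) = ord0.
by apply/val_inj; rewrite /= modnn.
Qed.

(** The nonvanishing on [Gr_wcb] makes the weak inequalities strict, and [P] carries them to the
    plane. *)
Lemma coarse_boundary_strict (C : 'M[R]_(k, k + 2)) (P : 'M[R]_(k + 2, 2)) :
  represents C Y -> coarse_boundary Z C -> oriented_quotient C P ->
  (forall i j : 'I_n.+2, j = i.+1 :> nat ->
     0 < det2 (row i (Z *m P)) (row j (Z *m P))) /\
  0 < (-1) ^+ k.+1 * det2 (row ord_max (Z *m P)) (row ord0 (Z *m P)).
Proof.
move=> rC [cb cbl] oP; have [b0 bl0] := wcb_bracket rC.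
rewrite !row_mul; split=> [i j ji|].
  rewrite !row_mul; have := oriented_quotient_gt0 (row i Z) (row j Z) false oP.
  by rewrite expr0 !mul1r => <-; rewrite lt_neqAle eq_sym b0 //=; apply: cb.
rewrite -signr_odd -(oriented_quotient_gt0 _ _ _ oP) signr_odd.
rewrite lt_neqAle eq_sym mulf_neq0 ?signr_eq0 //= -addn1.
exact: cbl.
Qed.

Lemma amplituhedron_winding : amplituhedron Z Y ->
  exists C : 'M[R]_(k, k + 2),
    [/\ represents C Y, has_polygon_winding Z C (Posz ((k + 1) %/ 2))
      & coarse_boundary Z C].
Proof.
move=> [GY [V [GV [C1 rC1 C1_ge0]] [C rC rY]]].
(* The image in the amplituhedron may use another representative of [V]; passing to [C1] makes
   nonnegative minors available. *)
have CC1 : (C1 == C)%MS by apply/(represents_eqmx _ rC1).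
have rC2 : represents (C1 *m Z) Y.
  apply/(represents_eqmx _ rY); move/andP: CC1 => [a b].
  by rewrite !submxMr.
have form_ge0 (i j : 'I_n.+2) : j = i.+1 :> nat ->
    0 <= bracket (C1 *m Z) (row i Z) (row j Z).
  move=> ji; apply: (row_form_mulmx_ge0 (@det_col_mx_row_multilinear _ _ _ _)
    (@det_col_mx_row_alternating _ _ _ _) C1_ge0) => g gi.
  exact: bracket_rowsub_succ_ge0.
have form_last (i j : 'I_n.+2) : i.+1 = n.+2 -> j = 0%N :> nat ->
    0 <= (-1) ^+ (k + 1) * bracket (C1 *m Z) (row i Z) (row j Z).
  move=> iN j0.
  apply: (row_form_mulmx_ge0
    (row_multilinear_scale ((-1) ^+ (k + 1)) (@det_col_mx_row_multilinear _ _ _ _))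
    (row_alternating_scale ((-1) ^+ (k + 1)) (@det_col_mx_row_alternating _ _ _ _))
    C1_ge0) => g gi.
  exact: bracket_rowsub_last_ge0.
have cb : coarse_boundary Z (C1 *m Z) by split.
have [b0 bl0] := wcb_bracket rC2.
pose i1 : 'I_n.+2 := lift ord0 ord0.
have b01 := b0 ord0 i1 erefl.
have [P oP] : exists P, oriented_quotient (C1 *m Z) P.
  apply: (@oriented_quotient_exists _ _ _ (row ord0 Z) (row i1 Z)).
  by rewrite lt_neqAle eq_sym b01 form_ge0.
have [d0 dlast] := coarse_boundary_strict rC2 cb oP.
have Pz (i : 'I_n.+2) : row i Z *m P = row i (Z *m P) by rewrite row_mul.
have [f f_incr C1f] : exists2 f : 'I_k -> 'I_n.+2, increasing f & 0 < \det (colsub f C1).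
  have [|f fi Cf] := @row_form_mulmx_minor _ _ _ _ _ C1 Z
    (det_col_mx_row_multilinear (col_mx (row ord0 Z) (row i1 Z)))
    (@det_col_mx_row_alternating _ _ _ _).
    by rewrite mulf_neq0 // pnatr_eq0 -lt0n fact_gt0.
  by exists f => //; rewrite lt_neqAle eq_sym Cf C1_ge0.
have [gamma [theta [gE th_cont nE]]] : exists (gamma : R -> 'rV[R]_2) (theta : R -> R),
    [/\ forall i s, (i < n.+2)%N -> 0 <= s <= 1 -> gamma (i%:R + s) =
          (1 - s) *: cyclic_row (Z *m P) i + s *: cyclic_row (Z *m P) i.+1,
        continuous theta
      & forall t, 0 <= t <= n.+2%:R -> normalize (gamma t) = unit_circle (theta t)].
  apply: polygon_lift => i i_n; have := cyclic_rowS (Z *m P) (Ordinal i_n).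
  rewrite (cyclic_row_ord _ (Ordinal i_n)) /= => ->.
  have [iE|i_n'] := eqVneq i n.+1.
    have -> : ordS (Ordinal i_n) = ord0 by apply/val_inj; rewrite /= iE modnn.
    have -> : Ordinal i_n = ord_max by apply/val_inj.
    by apply: contraTneq dlast => ->; rewrite mulr0 ltxx.
  rewrite gt_eqF // d0 //= modn_small // ltnS ltn_neqAle i_n'.
  by rewrite -ltnS.
have gP : closed_polygon (fun i : 'I_n.+2 => row i (Z *m P)) gamma.
  by move=> i s s01; rewrite gE // cyclic_row_ord cyclic_rowS.
have th_cont' : {within `[0, n.+2%:R], continuous theta} by apply: continuous_subspaceT.
have nE' t : t \in `[0, n.+2%:R] -> normalize (gamma t) = unit_circle (theta t).
  by rewrite in_itv /=; apply: nE.
have dlast' := dlast; rewrite -signr_odd in dlast'.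
have [phi [r [[phi0 steps] r0 wE clo sT]]] := polygon_angles d0 dlast' gP th_cont' nE'.
have gcl : gamma 0 = gamma n.+2%:R.
  have := gE 0%N 0 isT; have := gE n.+1 1 (ltnSn _).
  rewrite natr1 ler01 !lexx subrr subr0 !scale0r !scale1r !addr0 add0r => -> // -> //.
  rewrite (cyclic_row_ord _ ord0) (cyclic_rowS _ ord_max).
  by congr (row _ _); apply/val_inj; rewrite /= modnn.
have rng : k%:R * pi < phi n.+1 < k%:R * pi + pi.
  apply: (swept_angle_range C1_ge0 f_incr C1f _ _ phi0 steps r0 wE d0 dlast).
    by case: oP.
  by rewrite mulmxA; apply: oriented_quotient_mul0.
rewrite signr_odd in clo.
exists (C1 *m Z); split => //.
exists P, gamma; split => //.
  by move=> i s s01; rewrite gP // !Pz.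
split => //; exists theta; split => //.
exact: winding_of_swept_range clo (sT gcl) rng.
Qed.

Lemma winding_amplituhedron (C : 'M[R]_(k, k + 2)) :
  represents C Y -> has_polygon_winding Z C (Posz ((k + 1) %/ 2)) ->
  coarse_boundary Z C -> amplituhedron Z Y.
Proof.
move=> rC [P [gamma [oP gP [gcl [theta [th_cont nE thT]]]]]] cb.
have GY : Gr k Y by case: Ywcb.
have [d0 dlast] := coarse_boundary_strict rC cb oP.
have gP' : closed_polygon (fun i : 'I_n.+2 => row i (Z *m P)) gamma.
  by move=> i s s01; rewrite gP // !row_mul.
rewrite -signr_odd in dlast.
have [phi [r [[phi0 steps] r0 wE clo _]]] := polygon_angles d0 dlast gP' th_cont nE.
rewrite signr_odd in clo.
have /andP[/ltW phik _] := swept_range_of_winding clo thT.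
have [C' [f [C'_ge0 C'z f_incr f2 C'f]]] := crossing_matrix phi0 steps r0 wE d0 phik.
pose i1 : 'I_n.+2 := lift ord0 ord0.
have b0 : 0 < bracket (C' *m Z) (row ord0 Z) (row i1 Z).
  apply: (row_form_mulmx_gt0 (@det_col_mx_row_multilinear _ _ _ _)
    (@det_col_mx_row_alternating _ _ _ _) C'_ge0 _ C'f) => [g gi|].
    exact: bracket_rowsub_succ_ge0.
  exact: bracket_rowsub01_gt0.
have rf : row_free (C' *m Z) by apply: (bracket_neq0_row_free (lt0r_neq0 b0)).
have rfC : row_free C by apply/(Gr_row_free rC).
(* The rows of [C' *m Z] die in the quotient, so they lie in the row space of [C]; equality follows
   as both ranks are [k]. *)
have sub : (C' *m Z <= C)%MS.
  have [_ ker _] := oP; apply/row_subP => i; apply/ker.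
  by rewrite -row_mul -mulmxA C'z row0.
have eqC : (C == C' *m Z)%MS.
  rewrite andbC -(geq_leqif (mxrank_leqif_eq sub)).
  by rewrite (eqP (rf : \rank _ == k)) (eqP (rfC : \rank _ == k)).
have rC'Z : represents (C' *m Z) Y by apply/(represents_eqmx _ rC).
split => //; pose V := <<[seq row i C' | i : 'I_k]>>%VS.
have rV : represents C' V by [].
exists V; last by exists C'.
split; last by exists C'.
apply/(Gr_row_free rV).
(* The rank of [C'] is at least that of [C' *m Z], which is [k]. *)
rewrite /row_free eqn_leq rank_leq_row /=.
by move: rf; rewrite /row_free => /eqP {1}<-; apply: mxrankM_maxl.
Qed.

End Main.

Theorem corollary1p17 (R : realType) (n k : nat) (hn : (k + 2 <= n)%N)
    (Z : 'M[R]_(n, k + 2)) (hZ : Mat_gt0 Z)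
    (Y : {vspace 'rV[R]_(k + 2)}) (hY : Gr_wcb Z Y) :
  amplituhedron Z Y <->
  exists C : 'M[R]_(k, k + 2),
    [/\ represents C Y,
        has_polygon_winding Z C (Posz ((k + 1) %/ 2))
      & coarse_boundary Z C].
Proof.
(* The bound on [n] gives at least two vertices, hence the index type ['I_n.+2]. *)
case: n hn Z hZ hY => [|[|n]] hn Z hZ hY; first by exfalso; lia.
  by exfalso; lia.
split; first exact: amplituhedron_winding.
by case=> C [rC wC cb]; exact: winding_amplituhedron rC wC cb.
Qed.
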